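(* Let $G$ be a plane graph with a weight function on its edges; weight every edge of its planar dual $G^*$ by $1$, and weight each edge of the dual refinement $H_G$ by the weight of the edge of $G$ or $G^*$ containing it (edges of $H_G$ joining an edge-vertex on the unbounded face to a face-vertex get weight $1$). Let $v_1,\dots,v_{2n+1}$ and $v'_1,\dots,v'_{2n+1}$ be vertices on the boundary of the unbounded face of $G$ such that: $v'_1v'_2\cdots v'_{2n+1}$ is a path in $G$; $v_1,\dots,v_{2n+1},v'_{2n+1},\dots,v'_1$ appear in this counterclockwise cyclic order on that boundary; and $v_2,v_4,\dots,v_{2n},v'_2,\dots,v'_{2n}$ have degree $2$ and belong to distinct bounded faces of $G$. Let $\widehat{H}_G$ be obtained from $H_G$ by smashing in $v_2,\dots,v_{2n},v'_2,\dots,v'_{2n}$, with $f_{2i},f'_{2i}$ the face-vertices obtained by smashing in $v_{2i},v'_{2i}$. Let $G_0=G\setminus\{v_2,v_4,\dots,v_{2n},v'_2,\dots,v'_{2n}\}$, and let $\mathcal{F}$ be the set of spanning forests $F$ of $G_0$ consisting of exactly $n+1$ trees, the $i$-th containing both $v_{2i-1}$ and $v'_{2i-1}$ and rooted at $v'_{2i-1}$ ($i=1,\dots,n+1$), such that for each $i=1,\dots,n$ the vertices $f_{2i}$ and $f'_{2i}$ lie in the same channel of $F$. The weight of $F$ is the product of the weights of its edges. (a) There is a weight-preserving bijection between the perfect matchings of $\widehat{H}_G\setminus\{v'_1,f'_2,v'_3,\dots,f'_{2n},v'_{2n+1}\}$ and the forests in $\mathcal{F}$. (b) More generally, let $P_1,\dots,P_{2n+1}$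 be pairwise vertex-disjoint paths in $H_G$ such that $P_{2i-1}$ is (the subdivision of) a path in $G$ from $v_{2i-1}$ to $v'_{2i-1}$ ($i=1,\dots,n+1$) and $P_{2i}$ is (the subdivision of) a path in $G^*$ from $f_{2i}$ to $f'_{2i}$ ($i=1,\dots,n$), with $P_1,\dots,P_{2n+1}$ regarded as starting at $v_1,f_2,v_3,\dots,f_{2n},v_{2n+1}$, and let $\operatorname{e}_P$ denote the ending vertex of a path $P$. Then for every $I\subseteq[2n+1]$ there is a weight-preserving bijection between (1) the perfect matchings of $\widehat{H}_G\setminus\{v'_1,f'_2,v'_3,\dots,f'_{2n},v'_{2n+1}\}$ containing all edges of the unique perfect matching of $P_i\setminus\operatorname{e}_{P_i}$ for all $i\in I$, and (2) the forests $F\in\mathcal{F}$ such that for every odd $i\in I$ the path $P_i$ is contained in $F$, and for every even $i\in I$ the path $P_i$ is contained in a channel of $F$.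
   Context: Graphs have no loops or multiple edges; $G$ has no vertex of degree one inside a bounded face. The planar dual $G^*$ has a vertex for each bounded face of $G$ and an edge (dual to $e$) for each edge $e$ of $G$ separating two bounded faces; the dual graph $G^*\cup z$ adds a vertex $z$ for the unbounded face, adjacent to each vertex of $G^*$ whose face shares an edge with the unbounded face. The dual refinement $H_G$ has as vertices the original vertices of $G$, one face-vertex per bounded face and one edge-vertex per edge of $G$; the edge-vertex of $e$ is joined to the endpoints of $e$ and to the face-vertices of the bounded faces whose boundary contains $e$. Paths in $G$ or $G^*$ are regarded as paths in $H_G$ by inserting the edge-vertices of the traversed/crossed edges. Smashing in a degree-2 original vertex $v$ on the unbounded face means deleting $v$ and its two adjacent edge-vertices; the face-vertex of the bounded face containing $v$ is the one obtained by smashing in $v$. A spanning forest is rooted by choosing a root in each tree; edges are oriented toward the root of their tree. For a spanning forest $F$ of $G_0$, its dual forest $F^*$ is the subgraph of $G^*$ with all vertices of $G^*$ and those edges of $G^*$ whose dual edge of $G$ is not in $F$; a channel of $F$ is a connected component of $F^*$ containing two vertices adjacent to $z$ in $G^*\cup z$. The weight of a perfect matching is the product of its edge weights. *)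

(* Defs.v *)
From HB Require Import structures.
From mathcomp Require Import all_boot all_order all_algebra.

Set Implicit Arguments.
Unset Strict Implicit.
Unset Printing Implicit Defensive.

Import GRing.Theory.

(* A finite simple plane graph, given up to orientation-preserving
   homeomorphism of the plane by a combinatorial map.  A dart [(e, b)] is one
   of the two orientations of the edge [e]; [rot] sends a dart to the next one
   counterclockwise around its source, and [rface d] is the face to the right
   of [d].  Hence [d |-> rot (flip d)] follows the boundary of [rface d]
   keeping that face on the right: the unbounded face [outer] is followed
   counterclockwise.
   The graph is not assumed connected, so a face may have several boundary
   walks, and an isolated vertex, which has no dart, is a boundary component of
   the face [iface] ([iface] is irrelevant on the other vertices). *)

Definition flip (E : Type) (d : E * bool) : E * bool := (d.1, ~~ d.2).

Section Map.
Variables (V E F : finType) (src : E * bool -> V).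
Variables (rot : E * bool -> E * bool) (rface : E * bool -> F) (iface : V -> F).

Definition map_next (d : E * bool) : E * bool := rot (flip d).

Definition map_adj : rel V :=
  [rel x y | [exists d, (src d == x) && (src (flip d) == y)]].

Definition map_isolated (x : V) : bool := [forall d, src d != x].

Definition map_incident (x : V) (g : F) : bool :=
  [exists d, (src d == x) && (rface d == g)]
  || (map_isolated x && (iface x == g)).

Definition map_incidence_graph : rel (V + F) :=
  [rel p q | match p, q with
             | inl x, inr g | inr g, inl x => map_incident x g
             | _, _ => false
             end].

(* [sphere_components] says that every connected component has genus 0: the
   left side counts vertices and boundary walks, and no component can have
   Euler characteristic greater than 2.  The last two conditions say that the
   components are nested in one another's faces as in the plane: joining
   each component to the faces it bounds, by one link per boundary walk, gives
   a tree. *)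
Record map_planar : Prop := MapPlanar {
  sphere_components :
    #|V| + (fcard map_next predT + #|[set x | map_isolated x]|)
    = #|E| + (n_comp map_adj predT).*2;
  euler_formula : #|V| + #|F| = #|E| + n_comp map_adj predT + 1;
  incidence_connected : n_comp map_incidence_graph predT = 1 }.

End Map.

Record plane_graph := PlaneGraph {
  vertex : finType;
  edge : finType;
  face : finType;
  src : edge * bool -> vertex;
  rot : edge * bool -> edge * bool;
  rface : edge * bool -> face;
  iface : vertex -> face;
  outer : face;
  no_loop : forall d, src (flip d) != src d;
  no_multiple_edge : forall d d',
    src d = src d' -> src (flip d) = src (flip d') -> d = d';
  rot_inj : injective rot;
  rot_orbit : forall d d', fconnect rot d d' = (src d == src d');
  rface_next : forall d, rface (rot (flip d)) = rface d;
  planar : map_planar src rot rface iface }.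

Section PlaneGraph.
Variable G : plane_graph.

Definition dart : finType := (edge G * bool)%type.

Definition tgt (d : dart) : vertex G := src (flip d).

Definition lface (d : dart) : face G := rface (flip d).

Definition face_next : dart -> dart := map_next (@rot G).

Definition incident (x : vertex G) (g : face G) : bool :=
  map_incident (@src G) (@rface G) (@iface G) x g.

Definition deg (x : vertex G) : nat := #|[set d : dart | src d == x]|.

Definition no_inner_leaf : Prop :=
  forall d : dart, deg (src d) = 1 -> rface d = outer G.

Definition adj_in (F : {set edge G}) : rel (vertex G) :=
  [rel x y | [exists d : dart, [&& d.1 \in F, src d == x & tgt d == y]]].

Definition adj : rel (vertex G) := adj_in setT.

(* The vertices of [s] occur in this cyclic order, at distinct places, along
   a closed boundary walk of the unbounded face.  A vertex occurs on the walk
   once for each of its corners there. *)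
Definition ccw_on_outer (s : seq (vertex G)) : Prop :=
  exists2 d : dart, rface d = outer G &
    subseq s [seq src d' | d' <- orbit face_next d].

(* The vertices of the dual graph are the faces other than [outer], which plays
   the role of z. *)

Definition separates (e : edge G) : bool :=
  [&& rface (e, true) != outer G, rface (e, false) != outer G
    & rface (e, true) != rface (e, false)].

Definition adj_z (g : face G) : bool :=
  (g != outer G) && [exists d : dart, (rface d == g) && (lface d == outer G)].

Definition dual_adj (F : {set edge G}) : rel (face G) :=
  [rel g h | [exists d : dart,
    [&& d.1 \notin F, separates d.1, rface d == g & lface d == h]]].

Definition channel (F : {set edge G}) (C : {set face G}) : Prop :=
  (exists2 g, g != outer G & C = [set h | connect (dual_adj F) g h])
  /\ (exists g h, [/\ g \in C, h \in C, g != h, adj_z g & adj_z h]).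

(* Ambient type of the dual refinement; it also contains [fv (outer G)], which
   is not a vertex of the dual refinement. *)

Definition hvert : finType := (vertex G + face G + edge G)%type.

Definition ov (x : vertex G) : hvert := inl (inl x).
Definition fv (g : face G) : hvert := inl (inr g).
Definition ev (e : edge G) : hvert := inr e.

Definition hinc (e : edge G) (u : vertex G + face G) : bool :=
  match u with
  | inl x => [exists b, src (e, b) == x]
  | inr g => (g != outer G) && [exists b, rface (e, b) == g]
  end.

Definition hadj : rel hvert :=
  [rel p q | match p, q with
             | inr e, inl u | inl u, inr e => hinc e u
             | _, _ => false
             end].

Definition hverts : {set hvert} := [set~ fv (outer G)].

Definition smash (S : {set hvert}) (x : vertex G) : {set hvert} :=
  S :\: (ov x |: [set p | hadj (ov x) p]).

(* Only used for vertices of degree 2 on the unbounded face, which lie on at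
   most one bounded face; the value is [outer G] if there is none. *)
Definition smash_face (x : vertex G) : face G :=
  odflt (outer G) [pick g | (g != outer G) && incident x g].

Definition edges_within (S : {set vertex G}) : {set edge G} :=
  [set e | [forall b, src (e, b) \in S]].

Definition spanning_forest (S : {set vertex G}) (F : {set edge G}) : Prop :=
  F \subset edges_within S
  /\ (forall c, 2 < size c -> uniq c -> ~~ cycle (adj_in F) c).

End PlaneGraph.

Section Matchings.
Variable T : finType.

Definition perfect_matching (e : rel T) (S : {set T}) (M : {set {set T}}) :=
  [forall A in M, [exists x in S, [exists y in S,
     [&& x != y, e x y & A == [set x; y]]]]]
  && [forall x in S, #|[set A in M | x \in A]| == 1].

Definition path_adj (p : seq T) : rel T :=
  [rel x y | ((x, y) \in zip p (behead p)) || ((y, x) \in zip p (behead p))].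

End Matchings.

(* The dual graph may have multiple edges, so a path is given by the darts it
   follows (in the graph) or crosses (in the dual graph). *)

Section Walks.
Variables (D T : eqType) (s t : D -> T).

Fixpoint walk (x : T) (p : seq D) : bool :=
  if p is d :: p' then (s d == x) && walk (t d) p' else true.

Definition simple_path (x y : T) (p : seq D) : Prop :=
  [/\ walk x p, uniq (x :: map t p) & last x (map t p) = y].

End Walks.

Section Subdivision.
Variable G : plane_graph.

Definition subdivided_path (x y : vertex G) (s : seq (hvert G)) : Prop :=
  exists2 p : seq (dart G), simple_path (@src G) (@tgt G) x y p &
    s = ov x :: flatten [seq [:: ev d.1; ov (tgt d)] | d <- p].

Definition subdivided_dual_path (g h : face G) (s : seq (hvert G)) : Prop :=
  exists2 p : seq (dart G),
    simple_path (@rface G) (@lface G) g h p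
    /\ all (fun d : dart G => separates d.1) p &
    s = fv g :: flatten [seq [:: ev d.1; fv (lface d)] | d <- p].

Definition path_in_forest (S : {set vertex G}) (F : {set edge G})
    (s : seq (hvert G)) : Prop :=
  (forall x, ov x \in s -> x \in S) /\ (forall e, ev e \in s -> e \in F).

Definition path_in_channel (F : {set edge G}) (s : seq (hvert G)) : Prop :=
  exists C, [/\ channel F C, forall g, fv g \in s -> g \in C
              & forall e, ev e \in s -> e \notin F].

End Subdivision.

(* Indices start at 0: [v k] is the vertex usually written v_(k+1), so the
   smashed vertices are those of odd index [k]. *)

Section Configuration.
Variables (G : plane_graph) (n : nat).
Variables (v v' : 'I_n.*2.+1 -> vertex G).

Definition smashed : seq (vertex G) :=
  [seq v k | k : 'I_n.*2.+1 <- enum 'I_n.*2.+1 & odd k]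
  ++ [seq v' k | k : 'I_n.*2.+1 <- enum 'I_n.*2.+1 & odd k].

Definition G0_verts : {set vertex G} := [set x | x \notin smashed].

Definition terminal (u : 'I_n.*2.+1 -> vertex G) (k : 'I_n.*2.+1) : hvert G :=
  if odd k then fv (smash_face (u k)) else ov (u k).

Definition hat_verts : {set hvert G} := foldl (@smash G) (hverts G) smashed.

Definition matching (M : {set {set hvert G}}) : Prop :=
  perfect_matching (@hadj G) (hat_verts :\: [set terminal v' k | k : 'I_n.*2.+1]) M.

(* A forest is given by its edge set, since the roots are prescribed: the
   trees are indexed by the even [k], and the root of the [k]-th is [v' k]. *)
Definition forest (F : {set edge G}) : Prop :=
  [/\ spanning_forest G0_verts F,
      n_comp (adj_in F) G0_verts = n.+1,
      forall j k : 'I_n.*2.+1, ~~ odd j -> ~~ odd k -> j != k ->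
        ~~ connect (adj_in F) (v' j) (v' k),
      forall k : 'I_n.*2.+1, ~~ odd k -> connect (adj_in F) (v k) (v' k)
    & forall k : 'I_n.*2.+1, odd k -> exists2 C, channel F C &
        smash_face (v k) \in C /\ smash_face (v' k) \in C].

Definition path_system (P : 'I_n.*2.+1 -> seq (hvert G)) : Prop :=
  [/\ forall k : 'I_n.*2.+1, ~~ odd k -> subdivided_path (v k) (v' k) (P k),
      forall k : 'I_n.*2.+1, odd k ->
        subdivided_dual_path (smash_face (v k)) (smash_face (v' k)) (P k)
    & forall j k : 'I_n.*2.+1, j != k -> [disjoint P j & P k]].

Definition matching_along (P : 'I_n.*2.+1 -> seq (hvert G))
    (I : {set 'I_n.*2.+1}) (M : {set {set hvert G}}) : Prop :=
  matching M /\ forall k, k \in I ->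
    exists2 N, perfect_matching (path_adj (P k))
                 ([set x in P k] :\ terminal v' k) N
             & N \subset M.

Definition forest_along (P : 'I_n.*2.+1 -> seq (hvert G))
    (I : {set 'I_n.*2.+1}) (F : {set edge G}) : Prop :=
  forest F /\ forall k, k \in I ->
    if odd k then path_in_channel F (P k)
    else path_in_forest G0_verts F (P k).

End Configuration.

Section Weights.
Local Open Scope ring_scope.
Variables (R : comNzRingType) (G : plane_graph) (w : edge G -> R).

Definition hedge_weight (A : {set hvert G}) : R :=
  if [pick p : vertex G * edge G | A == [set ov p.1; ev p.2]] is Some p
  then w p.2 else 1.

Definition matching_weight (M : {set {set hvert G}}) : R :=
  \prod_(A in M) hedge_weight A.

Definition forest_weight (F : {set edge G}) : R := \prod_(e in F) w e.

End Weights.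

Definition weight_preserving_bijection (R X Y : Type) (A : X -> Prop)
    (B : Y -> Prop) (wA : X -> R) (wB : Y -> R) : Prop :=
  exists phi : X -> Y,
    [/\ forall x, A x -> B (phi x),
        forall x1 x2, A x1 -> A x2 -> phi x1 = phi x2 -> x1 = x2,
        forall y, B y -> exists2 x, A x & phi x = y
      & forall x, A x -> wB (phi x) = wA x].

(* Main.v *)
Require Import Defs.
From HB Require Import structures.
From mathcomp Require Import all_boot all_order all_algebra.
From mathcomp Require Import zify.

Set Implicit Arguments.
Unset Strict Implicit.
Unset Printing Implicit Defensive.

(* A perfect matching assigns an incident edge to every vertex of G_0 that is not
   a root, and to every bounded face that is not an f'.  Let F be the set of
   edges assigned to vertices and D the set of the other edges of G_0.

   Planarity enters only through two facts.  A cut and the boundary of a set of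
   faces meet in an even number of edges.  Hence, by Euler's formula, the
   numbers of components of any edge set X and of the dual graph of its
   complement determine each other when G is connected.

   A component of F without a root would enclose a region containing no removed
   vertex, in which more vertices and faces than edges are to be matched.  So F
   is a forest with one root in each tree.  Adding to F the edges at the smashed
   v', which link all the roots since v'_1 ... v'_(2n+1) is a path, and then
   dualizing shows that D is a dual forest in which z and the f_(2i) lie in
   distinct trees; counting again, each of these trees contains exactly one of z
   and the f'_(2i).  If f_(2i) is linked to f'_(2j), parity shows that the two
   neighbours of v_(2i) lie in the trees of the two neighbours of v'_(2j).  An
   edge on the unbounded face has both ends in the same tree of F unless it
   meets a smashed vertex, so going along the boundary from v'_(2n+1) back to
   v_1 gives i = j for every i, and that v_(2i+1) lies in the tree of v'_(2i+1).

   Conversely, the channels of a forest make its dual a forest rooted at z and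
   the f', and orienting both forests toward their roots gives the matching; it
   is the only one, because a rooted forest has only one assignment of its edges
   to its nonroot vertices. *)

(** * Perfect matchings and subdivided paths *)

Lemma perfect_matchingP (T : finType) (e : rel T) (S : {set T}) (M : {set {set T}}) :
  reflect ((forall A, A \in M -> exists x y,
             [/\ x \in S, y \in S, x != y, e x y & A = [set x; y]])
           /\ forall x, x \in S -> exists A,
             [/\ A \in M, x \in A & forall B, B \in M -> x \in B -> B = A])
          (perfect_matching e S M).
Proof.
apply: (iffP andP) => -[H1 H2]; split.
- move=> A AM; have /existsP[x /andP[xS /existsP[y /and4P[yS xy exy /eqP AE]]]] :=
    implyP (forallP H1 A) AM.
  by exists x, y.
- move=> x xS; have /cards1P[A AE] := implyP (forallP H2 x) xS.
  have : A \in [set A in M | x \in A] by rewrite AE set11.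
  rewrite inE => /andP[AM xA]; exists A; split=> // B BM xB.
  by apply/set1P; rewrite -AE inE BM.
- apply/forallP => A; apply/implyP => /H1[x [y [xS yS xy exy AE]]].
  by apply/existsP; exists x; rewrite xS; apply/existsP; exists y; rewrite yS xy exy AE /=.
apply/forallP => x; apply/implyP => /H2[A [AM xA AU]]; apply/cards1P; exists A.
apply/setP => B; rewrite !inE; apply/andP/eqP => [[]|->] //; exact: AU.
Qed.

Lemma set2_inl_inr (T1 T2 : finType) (u u' : T1) (e e' : T2) :
  [set inl u; inr e] = [set inl u'; inr e'] :> {set T1 + T2} -> u = u' /\ e = e'.
Proof.
move=> E; have : inl u \in ([set inl u'; inr e'] : {set T1 + T2}) by rewrite -E set21.
have : inr e \in ([set inl u'; inr e'] : {set T1 + T2}) by rewrite -E set22.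
by rewrite !inE => /eqP[->] /orP[/eqP[->]|].
Qed.

Section Subdivision.
Variables (C U E : finType) (s : E * bool -> U) (c : U -> C).
Notation t := (fun d => s (flip d)).
Notation T := (C + E)%type.

(** The choices [s := src] and [s := rface] treat paths in G and in the dual alike; [c] places
    vertices or faces among the vertices of H_G that are not edge-vertices. *)
Definition subdivision (x : U) (p : seq (E * bool)) : seq T :=
  inl (c x) :: flatten [seq [:: inr d.1; inl (c (t d))] | d <- p].

Lemma mem_subdivision_inl x p a :
  (inl a \in subdivision x p) = (a \in [seq c u | u <- x :: [seq t d | d <- p]]).
Proof.
rewrite /subdivision inE [in RHS]/= inE; congr (_ || _).
by elim: p => //= d p IH; rewrite !inE -IH.
Qed.

Lemma mem_subdivision_inr x p e :
  (inr e \in subdivision x p) = (e \in [seq d.1 | d <- p]).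
Proof. by rewrite inE /=; elim: p => //= d p IH; rewrite !inE -IH. Qed.

Lemma subdivision_adj x p d : walk s t x p -> d \in p ->
  path_adj (subdivision x p) (inl (c (s d))) (inr d.1).
Proof.
move=> + dp; rewrite /path_adj /= => wp; apply/orP; left.
elim: p x wp dp => //= d' p IH x /andP[/eqP d'x wp].
by rewrite !inE => /predU1P[->|/(IH _ wp)->]; rewrite ?d'x ?eqxx ?orbT.
Qed.

Lemma walk_source x p u : walk s t x p -> u \in x :: [seq t d | d <- p] ->
  u != last x [seq t d | d <- p] -> exists2 d, d \in p & s d = u.
Proof.
elim: p x => [|d p IH] x /=; first by rewrite inE => _ ->.
case/andP=> /eqP dx wp; rewrite inE => /predU1P[->|up ul].
  by exists d; rewrite ?mem_head.
by have [d' d'p d'u] := IH _ wp up ul; exists d'; rewrite // inE d'p orbT.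
Qed.

(** Each step of the path pairs its source with its edge-vertex, which leaves out only the end. The
    pairs belong to [M], and this is why they do not overlap. *)
Lemma subdivision_matching (h : rel T) (S : {set T}) M x p :
    injective c -> perfect_matching h S M -> walk s t x p ->
    {in p, forall d, s d != last x [seq t d | d <- p]} ->
    {in p, forall d, [set inl (c (s d)); inr d.1] \in M} ->
  exists2 N, perfect_matching (path_adj (subdivision x p))
      ([set y in subdivision x p] :\ inl (c (last x [seq t d | d <- p]))) N
    & N \subset M.
Proof.
move=> cI /perfect_matchingP[ME MU] wp pl pM.
pose N : {set {set T}} := [set A in [seq [set inl (c (s d)); inr d.1] | d <- p]].
have NM : N \subset M.
  by apply/subsetP => A; rewrite inE => /mapP[d dp ->]; exact: pM.
exists N => //; apply/perfect_matchingP.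
have sP d : d \in p -> s d \in x :: [seq t d | d <- p].
  elim: p x wp {pl pM N NM} => //= d' p IH x /andP[/eqP d'x wp].
  rewrite inE => /predU1P[->|/(IH _ wp)]; first by rewrite d'x mem_head.
  by move=> H; rewrite inE H orbT.
split=> [A|y].
  rewrite inE => /mapP[d dp ->]; exists (inl (c (s d))), (inr d.1); split=> //.
  - rewrite in_setD1 in_set mem_subdivision_inl; apply/andP; split.
      by apply: contraNneq (pl d dp) => -[/cI ->].
    by apply/mapP; exists (s d); rewrite ?sP.
  - by rewrite in_setD1 in_set mem_subdivision_inr; apply/mapP; exists d.
  - exact: subdivision_adj.
rewrite in_setD1 inE => /andP[yl yp].
have [d dp yd] : exists2 d, d \in p & y \in [set inl (c (s d)); inr d.1].
  case: y yl yp => [a|e] yl.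
    rewrite mem_subdivision_inl => /mapP[u up ua]; rewrite ua in yl *.
    have [|d dp du] := walk_source wp up; first by apply: contraNneq yl => ->.
    by exists d; rewrite // du set21.
  by rewrite mem_subdivision_inr => /mapP[d dp ->]; exists d; rewrite // set22.
exists [set inl (c (s d)); inr d.1]; split=> //; first by rewrite in_set; apply/mapP; exists d.
move=> B /(subsetP NM) BM yB; have dM := pM d dp.
have yS : y \in S.
  by have [x1 [x2 [x1S x2S _ _ BE]]] := ME B BM; move: yB; rewrite BE => /set2P[]->.
by have [A [_ _ AU]] := MU y yS; rewrite (AU B) // (AU _ dM).
Qed.

End Subdivision.

(** * Multigraphs *)

Section Multigraph.
Variables (U E : finType) (s : E * bool -> U).
Implicit Types (X Y : {set E}) (R : {set U}) (u x y : U) (e : E) (d : E * bool).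

(** The instance [s := src] is G and [s := rface] is its dual with z = [outer G], so loops and
    parallel edges have to be allowed. *)
Definition eadj X : rel U :=
  [rel x y | [exists d, [&& d.1 \in X, s d == x & s (flip d) == y]]].

Definition econn X : rel U := connect (eadj X).

Definition ncomp X := n_comp (eadj X) predT.

Definition ends e u := [exists b, s (e, b) == u].

Lemma flipK : involutive (@flip E).
Proof. by case=> e b; rewrite /flip /= negbK. Qed.

Lemma eq_edge d d' : d.1 = d'.1 -> d = d' \/ d = flip d'.
Proof.
by case: d d' => e b [e' b'] /= ->; case: b b' => [] []; auto.
Qed.

Lemma eadjP X x y :
  reflect (exists d, [/\ d.1 \in X, s d = x & s (flip d) = y]) (eadj X x y).
Proof.
apply: (iffP existsP) => [[d /and3P[? /eqP ? /eqP ?]]|[d [? ? ?]]]; exists d.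
  by split.
by apply/and3P; split => //; apply/eqP.
Qed.

Lemma eadj_sym X : symmetric (eadj X).
Proof.
by move=> x y; apply/eadjP/eadjP=> -[d [dX dx dy]]; exists (flip d); rewrite flipK.
Qed.

Lemma econn_sym X : symmetric (econn X).
Proof. exact: sym_connect_sym (@eadj_sym X). Qed.

Lemma econn0 X x : econn X x x.
Proof. exact: connect0. Qed.

Lemma econn_trans X : transitive (econn X).
Proof. exact: connect_trans. Qed.

Lemma same_econn X x y : econn X x y -> econn X x =1 econn X y.
Proof. exact: same_connect (@econn_sym X) _ _. Qed.

Lemma econn_edge X d : d.1 \in X -> econn X (s d) (s (flip d)).
Proof. by move=> dX; apply: connect1; apply/eadjP; exists d. Qed.

Lemma econn_closed X (S : {pred U}) x y :
    (forall d, d.1 \in X -> s d \in S -> s (flip d) \in S) ->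
  econn X x y -> x \in S -> y \in S.
Proof.
move=> clS xy xS; rewrite -(closed_connect _ xy) //.
apply: (intro_closed (@econn_sym X)) => a b /eadjP[d [dX <- <-]]; exact: clS.
Qed.

Lemma econn_sub X Y x y : X \subset Y -> econn X x y -> econn Y x y.
Proof.
move=> /subsetP XY xy; apply: (econn_closed _ xy); last exact: econn0.
move=> d /XY dY xd; exact: econn_trans xd (econn_edge dY).
Qed.

Lemma ncompE (T : finType) (rho : U -> T) X :
    (forall x y, econn X x y = (rho x == rho y)) ->
  ncomp X = #|[set rho x | x in U]|.
Proof.
move=> rhoE; rewrite /ncomp /n_comp_mem -(card_in_imset (D := predI (roots (eadj X)) predT)
  (f := rho)) => [|x y]; last first.
  rewrite !inE !andbT => /eqP rx /eqP ry /eqP; rewrite -rhoE.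
  by move/(fingraph.rootP (@econn_sym X)); rewrite rx ry.
apply: eq_card => t; apply/imsetP/imsetP=> -[x _ ->]; last first.
  exists (fingraph.root (eadj X) x); first by rewrite !inE roots_root //; exact: econn_sym.
  by apply/eqP; rewrite -rhoE; exact: connect_root.
by exists x.
Qed.

Lemma ncomp0 : ncomp set0 = #|U|.
Proof.
rewrite (@ncompE _ id); first by rewrite card_imset.
move=> x y /=; apply/idP/eqP=> [xy|->]; last exact: econn0.
apply/esym/set1P; have := set11 x; apply: econn_closed xy.
by move=> d; rewrite in_set0.
Qed.

(** A path can be shortened until it uses the new edge at most once, in one of its two
    directions. *)
Lemma econnU1 X d x y : econn (d.1 |: X) x y =
  [|| econn X x y, econn X x (s d) && econn X (s (flip d)) y
    | econn X x (s (flip d)) && econn X (s d) y].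
Proof.
apply/idP/idP=> [xy|]; last first.
  have dX : econn (d.1 |: X) (s d) (s (flip d)) by rewrite econn_edge ?setU11.
  have XdX u v : econn X u v -> econn (d.1 |: X) u v by apply: econn_sub; rewrite subsetUr.
  case/or3P=> [/XdX //|/andP[/XdX xd /XdX dy]|/andP[/XdX xd /XdX dy]].
    exact: econn_trans xd (econn_trans dX dy).
  by apply: econn_trans xd (econn_trans _ dy); rewrite econn_sym.
set S := [pred y | [|| econn X x y, econn X x (s d) && econn X (s (flip d)) y
    | econn X x (s (flip d)) && econn X (s d) y]].
suff : y \in S by [].
apply: (econn_closed _ xy); last by rewrite inE econn0.
move=> d'; rewrite in_setU1 => /orP[/eqP d'd|d'X]; last first.
  have := econn_edge d'X => d'c; rewrite !inE => /or3P[H|/andP[-> H]|/andP[-> H]].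
  - by rewrite (econn_trans H d'c).
  - by rewrite (econn_trans H d'c) orbT.
  - by rewrite (econn_trans H d'c) !orbT.
by case: (eq_edge d'd) => ->; rewrite ?flipK !inE !econn0 !andbT;
  case: (econn X x (s d)); case: (econn X x (s (flip d))); rewrite ?orbT.
Qed.

Lemma ncompU1 X d :
  ncomp X = ncomp (d.1 |: X) + ~~ econn X (s d) (s (flip d)).
Proof.
case: (boolP (econn X _ _)) => [dc|ndc]; rewrite ?addn0 ?addn1.
  apply: eq_n_comp => x y; apply/idP/idP=> [|xy].
    by apply: econn_sub; rewrite subsetUr.
  change (econn X x y); change (is_true (econn (d.1 |: X) x y)) in xy.
  move: xy; rewrite econnU1 => /or3P[//|/andP[xd dy]|/andP[xd dy]].
    exact: econn_trans xd (econn_trans dc dy).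
  by apply: econn_trans xd (econn_trans _ dy); rewrite econn_sym.
pose r := fingraph.root (eadj X).
have rE x y : econn X x y = (r x == r y).
  by rewrite root_connect //; exact: econn_sym.
pose a := r (s d); pose b := r (s (flip d)).
(* [rho] merges the component of [s (flip d)] into that of [s d], so it classifies the components
   after [d] is added. *)
pose rho x := if r x == b then a else r x.
have ab : a != b by rewrite -rE.
have rK x : r (r x) = r x by rewrite /r root_root //; exact: econn_sym.
rewrite (@ncompE _ r X) // (@ncompE _ rho (d.1 |: X)); last first.
  move=> x y; rewrite econnU1 !rE -/a -/b /rho.
  case: (eqVneq (r x) b) => [->|xb]; case: (eqVneq (r y) b) => [->|yb] /=;
    by rewrite ?eqxx ?andbF ?andbT ?orbF ?(negPf xb).
rewrite (cardsD1 b) imset_f ?add1n ?inE //; congr _.+1.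
apply: eq_card => t; rewrite !inE; apply/andP/imsetP.
  by case=> tb /imsetP[x _ tE]; exists x => //; rewrite /rho -tE (negPf tb).
case=> x _ ->; rewrite /rho; case: (eqVneq (r x) b) => [_|xb]; split=> //.
  by apply/imsetP; exists (s d).
by apply/imsetP; exists x.
Qed.

(** Induction on the edges added to [X]. The new edge is given by a dart because [ncompU1] speaks of
    its two ends. *)
Lemma sub_set_ind (P : {set E} -> Prop) X : P X ->
    (forall Y d, d.1 \notin Y -> P Y -> P (d.1 |: Y)) ->
  forall Y, X \subset Y -> P Y.
Proof.
move=> PX PU Y; have [m] := ubnP #|Y :\: X|.
elim: m => // m IH in Y * => YXm XY.
have [/eqP|[e]] := set_0Vmem (Y :\: X).
  by rewrite setD_eq0 => YX; rewrite (_ : Y = X) //; apply/eqP; rewrite eqEsubset YX.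
rewrite inE => /andP[eX eY]; rewrite -(setD1K eY).
apply: (PU _ (e, true)); first by rewrite !inE eqxx.
apply: IH; last by rewrite subsetD1 XY.
apply: leq_trans (YXm : #|Y :\: X| <= m).
rewrite [X in _ < X](cardsD1 e) inE eX eY /= add1n ltnS subset_leq_card //.
by apply/subsetP=> e'; rewrite !inE => /and3P[-> -> ->].
Qed.

Lemma leq_card_ncomp X : #|U| <= ncomp X + #|X|.
Proof.
apply: (sub_set_ind (P := fun X => #|U| <= ncomp X + #|X|) _ _ (sub0set X)).
  by rewrite ncomp0 leq_addr.
move=> {}X d dX IH; apply: leq_trans IH _; rewrite (ncompU1 X d) cardsU1 dX /=.
by rewrite -addnA leq_add2l leq_add2r leq_b1.
Qed.

Lemma leq_ncomp R X : (forall u, exists2 r, r \in R & econn X u r) ->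
  ncomp X <= #|R|.
Proof.
move=> RX; rewrite (@ncompE _ (fingraph.root (eadj X))); last first.
  by move=> x y; rewrite root_connect //; exact: econn_sym.
apply: leq_trans (leq_imset_card (fingraph.root (eadj X)) (mem R)).
apply/subset_leq_card/subsetP => _ /imsetP[u _ ->].
have [r rR /(fingraph.rootP (@econn_sym X)) ->] := RX u; exact: imset_f.
Qed.

(** The elements of [R] have distinct component representatives, and by the bound these exhaust the
    components. *)
Lemma ncomp_roots R X : {in R &, forall r r', econn X r r' -> r = r'} ->
  ncomp X <= #|R| -> forall u, exists2 r, r \in R & econn X u r.
Proof.
pose rt := fingraph.root (eadj X) => RI.
have rtE x y : econn X x y = (rt x == rt y).
  by rewrite root_connect //; exact: econn_sym.
rewrite (ncompE rtE) => cR u.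
have : rt u \in rt @: R.
  suff -> : rt @: R = [set rt x | x in U] by apply/imsetP; exists u.
  apply/eqP; rewrite eqEcard; apply/andP; split.
    by apply/subsetP => _ /imsetP[x _ ->]; apply/imsetP; exists x.
  by rewrite [X in _ <= X]card_in_imset // => x y xR yR /eqP; rewrite -rtE => /RI->.
by case/imsetP => r rR /eqP; rewrite -rtE; exists r.
Qed.

(** Everything outside [K] is isolated, and the component of [u] is one more. With [K := setT] this
    says that there is a component. *)
Lemma ltn_ncomp (K : {set U}) u X : u \in K ->
    (forall d, d.1 \in X -> s d \in K) -> #|~: K| < ncomp X.
Proof.
move=> uK XK; have iso x y : x \notin K -> econn X x y -> x = y.
  move=> xK xy; apply/esym/set1P; apply: (econn_closed _ xy); last exact: set11.
  by move=> d /XK dK /set1P dx; rewrite -dx dK in xK.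
have rK x : x \notin K -> fingraph.root (eadj X) x = x.
  by move=> xK; rewrite -(iso _ _ xK (connect_root _ _)).
rewrite (@ncompE _ (fingraph.root (eadj X))); last first.
  by move=> x y; rewrite root_connect //; exact: econn_sym.
have ruK : fingraph.root (eadj X) u \notin ~: K.
  rewrite inE negbK; apply: contraTT uK => rK'.
  have /(iso _ _ rK') <- // : econn X (fingraph.root (eadj X) u) u.
  by rewrite econn_sym; exact: connect_root.
rewrite [X in _ < X](cardsD1 (fingraph.root (eadj X) u)) imset_f // add1n ltnS.
apply/subset_leq_card/subsetP => x xK; rewrite !inE (memPn ruK) //=.
by apply/imsetP; exists x => //; rewrite rK //; rewrite inE in xK.
Qed.

(** * Rooted forests and assignments of edges *)

Lemma ends_econn X e u v : e \in X -> ends e u -> ends e v -> econn X u v.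
Proof.
move=> eX /existsP[b /eqP <-] /existsP[b' /eqP <-].
have := @econn_edge X (e, b) eX; rewrite /flip /=.
by case: b b' => [] [] //=; rewrite ?econn0.
Qed.

(** With [leq_card_ncomp], the count forces [X] to be a forest with exactly one element of [R] in
    each tree. *)
Definition rooted X R :=
  (forall u, exists2 r, r \in R & econn X u r) /\ #|X| + #|R| = #|U|.

Lemma rooted_ncomp X R : rooted X R -> ncomp X = #|R|.
Proof.
case=> XR cXR; apply/eqP; rewrite eqn_leq leq_ncomp //=.
by rewrite -(leq_add2l #|X|) cXR addnC leq_card_ncomp.
Qed.

Lemma rooted_roots X R r r' : rooted X R ->
  r \in R -> r' \in R -> econn X r r' -> r = r'.
Proof.
move=> XR rR r'R rr'; apply/eqP/negPn/negP => neq.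
have: ncomp X <= #|R :\ r'|.
  apply: leq_ncomp => u; have [r1 r1R ur1] := XR.1 u.
  have [r1r'|] := eqVneq r1 r'; last by exists r1; rewrite // !inE r1R andbT.
  exists r; first by rewrite !inE neq rR.
  by rewrite r1r' in ur1; apply: econn_trans ur1 _; rewrite econn_sym.
by rewrite (rooted_ncomp XR) (cardsD1 r' R) r'R add1n ltnn.
Qed.

(** Deleting an edge that is not a bridge would leave too few edges for [leq_card_ncomp]. *)
Lemma rooted_bridge X R d : rooted X R -> d.1 \in X ->
  ~~ econn (X :\ d.1) (s d) (s (flip d)).
Proof.
move=> XR dX; apply/negP => dc; have := leq_card_ncomp (X :\ d.1).
rewrite (ncompU1 _ d) dc addn0 setD1K // (rooted_ncomp XR) -XR.2.
by rewrite (cardsD1 d.1 X) dX addnC leq_add2l add1n ltnn.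
Qed.

Lemma rooted_acyclic X R c : rooted X R -> 2 < size c -> uniq c ->
  ~~ cycle (eadj X) c.
Proof.
case: c => [|x [|y [|z c]]] // XR _ xyzc; apply/negP.
rewrite /cycle rcons_path [path _ x _]/= => /andP[/andP[exy yzc] lx].
have [d [dX dx dy]] := eadjP _ _ _ exy.
have /negP[] := rooted_bridge XR dX; rewrite dx dy econn_sym.
(* Every edge of the cycle after the first has an end outside [x] and [y], hence differs from [d];
   so the rest of the cycle bypasses the bridge [d]. *)
have off u v : (u \notin [:: x; y]) || (v \notin [:: x; y]) ->
    eadj X u v -> eadj (X :\ d.1) u v.
  move=> uv /eadjP[d' [d'X d'u d'v]]; apply/eadjP; exists d'; split=> //.
  rewrite !inE d'X andbT; apply: contraTN uv => /eqP/eq_edge[] dd';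
    by rewrite -d'u -d'v dd' ?flipK dx dy !inE !eqxx !orbT.
have zc : all [predC [:: x; y]] (z :: c).
  apply/allP => u uzc; move: xyzc; rewrite -[[:: x, y, z & c]]/([:: x; y] ++ z :: c).
  by rewrite cat_uniq => /and3P[_ /hasPn/(_ _ uzc)].
have offP : {in [predC [:: x; y]] &, subrel (eadj X) (eadj (X :\ d.1))}.
  by move=> u v uP _; apply: off; apply/orP; left.
have lP := allP zc _ (mem_last z c).
have zP := allP zc _ (mem_head z c).
move: yzc lx => /= /andP[yz zcX] lx.
apply: (@econn_trans _ z).
  by apply/connect1/off => //; apply/orP; right.
apply: (@econn_trans _ (last z c)); last first.
  by apply/connect1/off => //; apply/orP; left.
by apply/connectP; exists c => //; exact: (sub_in_path offP zc).
Qed.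

(** [h] is the distance to [R], and [p u] is the first edge of a shortest path from [u] to [R]; [e0]
    is the value of [p] on [R]. *)
Lemma rooted_parent X R (e0 : E) : rooted X R ->
  exists (p : U -> E) (h : U -> nat), forall u, u \notin R ->
    exists b, [/\ p u \in X, s (p u, b) = u & h (s (p u, ~~ b)) < h u].
Proof.
case=> XR _.
pose reach := fix reach n : {set U} := if n is n'.+1 then
  reach n' :|: [set u | [exists v in reach n', eadj X u v]] else R.
have reachP u : exists n, u \in reach n.
  have [r rR ur] := XR u; rewrite econn_sym in ur.
  have/connectP[p] := ur; elim/last_ind: p u {ur} => [|p v IH] u /=.
    by move=> _ ->; exists 0.
  rewrite rcons_path last_rcons => /andP[/IH/(_ erefl) [n ln] lv] ->.
  exists n.+1; rewrite /= !inE; apply/orP; right.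
  by apply/existsP; exists (last r p); rewrite ln eadj_sym.
pose h u := ex_minn (reachP u).
have hP u : u \in reach (h u) by rewrite /h; case: ex_minnP.
have h_le u n : u \in reach n -> h u <= n.
  by rewrite /h; case: ex_minnP => m _ /(_ n).
suff /fin_all_exists[p pP] : forall u, exists e, u \notin R ->
    exists b, [/\ e \in X, s (e, b) = u & h (s (e, ~~ b)) < h u].
  by exists p, h.
move=> u; have [uR|uR] := boolP (u \in R); first by exists e0.
have := hP u; case hu: (h u) => [|n] /=; first by rewrite (negPf uR).
rewrite !inE => /orP[/h_le|]; first by rewrite hu ltnn.
case/existsP => v /andP[vn /eadjP[[e b] /= [eX eu ev]]]; exists e => _.
by exists b; split=> //; rewrite ltnS -[s _]/(s (flip (e, b))) ev h_le.
Qed.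

(** One half of a perfect matching: the edges matched to original vertices when [s := src], to
    face-vertices when [s := rface]. *)
Definition assigned X R (m : U -> E) :=
  [/\ {in ~: R, forall u, m u \in X}, {in ~: R, forall u, ends (m u) u}
    & {in ~: R &, injective m}].

(** Take the parent edges. Two elements sharing one would be its two ends, each nearer to [R] than
    the other. *)
Lemma rooted_assigned X R (e0 : E) : rooted X R -> exists m, assigned X R m.
Proof.
move=> XR; have [p [h ph]] := rooted_parent e0 XR; exists p; split.
- by move=> u; rewrite inE => /ph[b []].
- by move=> u; rewrite inE => /ph[b [_ pu _]]; apply/existsP; exists b; rewrite pu.
move=> u v; rewrite !inE => /ph[b [_ pu hu]] /ph[b' [_ pv hv]] puv.
rewrite -puv in pv hv; have [bb'|] := eqVneq b b'; first by rewrite -pu bb' pv.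
by case: b b' pu pv hu hv => [] [] //= -> -> /ltnW; rewrite leqNgt => /negPf->.
Qed.

Lemma assigned_image X R m : assigned X R m -> #|X| + #|R| = #|U| ->
  m @: (~: R) = X.
Proof.
case=> mX _ mI cX; apply/eqP; rewrite eqEcard; apply/andP; split.
  by apply/subsetP => _ /imsetP[u uR ->]; exact: mX.
by rewrite card_in_imset // -(leq_add2r #|R|) cX addnC cardsC.
Qed.

(** Both assignments are compared with the parent map [p], by induction on the distance [h]. The
    edge [p v] is assigned to one of its ends; if this were the nearer end [w], induction would give
    [p w = p v], making [v] the parent of [w]. *)
Lemma rooted_assigned_eq X R m m' : rooted X R ->
  assigned X R m -> assigned X R m' -> {in ~: R, m =1 m'}.
Proof.
move=> XR mA m'A u uR; have [p [h ph]] := rooted_parent (m u) XR.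
suff eqp m1 : assigned X R m1 -> forall v, v \in ~: R -> m1 v = p v.
  by rewrite !eqp.
move=> m1A v; have := assigned_image m1A XR.2; case: m1A => m1X m1e m1I m1X'.
have [n] := ubnP (h v); elim: n v => // n IH v hn vR.
have [b [pX pv hv]] := ph v (etrans (esym (in_setC _ _)) vR).
have : p v \in m1 @: (~: R) by rewrite m1X'.
case/imsetP => w wR pw; have := m1e w wR; rewrite -pw => /existsP[b' /eqP pw'].
have [bb'|] := eqVneq b' b; first by rewrite pw -pw' bb' pv.
move=> bb'; have {bb'} bE : b' = ~~ b by case: b b' bb' {pv pw' hv} => [] [].
rewrite bE in pw'; rewrite pw' in hv.
have := IH w (leq_trans hv hn) wR; rewrite -pw => pvw.
have [b2 [_ pw2 hw]] := ph w (etrans (esym (in_setC _ _)) wR).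
have : b2 = b \/ b2 = ~~ b by case: (b) (b2) => [] []; auto.
rewrite -pvw in pw2 hw.
case=> b2E; rewrite b2E in pw2 hw; first by rewrite pw -pw2 pv.
by rewrite negbK pv ltnNge ltnW in hw.
Qed.

(** Exchange of root sets. A union of trees missing [R] would carry, through [m], as many edges as
    vertices, whereas each of its trees has one edge fewer because of its root in [R1]. *)
Lemma assigned_rooted X R R1 m : rooted X R1 -> assigned X R m ->
  #|X| + #|R| = #|U| -> rooted X R.
Proof.
move=> XR1 mA cX; split=> // u; case: mA => mX me mI.
pose L := [set v | [forall r in R, ~~ econn X v r]].
have LR : L \subset ~: R.
  apply/subsetP=> v; rewrite !inE => /forall_inP Lv; apply: contraTN isT => vR.
  by have := Lv v vR; rewrite econn0.
have Lc v w : econn X v w -> v \in L -> w \in L.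
  move=> vw; rewrite !inE => /forall_inP Lv; apply/forall_inP => r /Lv.
  by apply: contraNN; exact: econn_trans.
suff L0 : L = set0.
  have : u \notin L by rewrite L0 inE.
  by rewrite inE negb_forall_in => /exists_inP[r rR]; rewrite negbK; exists r.
have [//|[w wL]] := set_0Vmem L.
have [r rR1 wr] := XR1.1 w.
have [p pA] := rooted_assigned (m w) XR1; have pX := assigned_image pA XR1.2.
case: pA => pX' pe pI.
(* The parent edges of [W] with respect to [R1] are exactly [m @: L]. Hence [W], which lies in [L],
   is as large as [L], yet it contains no element of [R1]. *)
pose W := [set v in ~: R1 | p v \in m @: L].
have WL : W \subset L.
  apply/subsetP => v; rewrite inE => /andP[vR1 /imsetP[l lL pv]].
  have lR := subsetP LR l lL; apply: Lc lL.
  by apply: (ends_econn (mX _ lR) (me _ lR)); rewrite -pv pe.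
have WE : W = L.
  apply/eqP; rewrite eqEcard WL -(card_in_imset (D := L) (f := m)).
    have -> : m @: L = p @: W.
      apply/setP=> e; apply/idP/imsetP=> [eL|[v]]; last first.
        by rewrite inE => /andP[_ pv] ->.
      have : e \in p @: (~: R1).
        rewrite pX; case/imsetP: eL => l lL ->; exact/mX/(subsetP LR).
      by case/imsetP => v vR1 ev; exists v; rewrite // inE vR1 -ev.
    exact: leq_imset_card.
  by move=> a b /(subsetP LR) aR /(subsetP LR) bR; exact: mI.
have : r \in W by rewrite WE (Lc _ _ wr wL).
by rewrite !inE rR1.
Qed.

Lemma acyclic_ncomp X :
    (forall d, s (flip d) != s d) ->
    (forall d d', s d = s d' -> s (flip d) = s (flip d') -> d = d') ->
    (forall c, 2 < size c -> uniq c -> ~~ cycle (eadj X) c) ->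
  ncomp X + #|X| = #|U|.
Proof.
move=> noloop nomulti acyc.
apply: (sub_set_ind (P := fun Y => Y \subset X -> ncomp Y + #|Y| = #|U|) _ _
  (sub0set X) (subxx X)); first by rewrite ncomp0 cards0 addn0.
move=> Y d dY IH dYX; have YX := subset_trans (subsetUr _ _) dYX.
rewrite -(IH YX) (ncompU1 Y d) cardsU1 dY /=.
suff -> : ~~ econn Y (s d) (s (flip d)) by rewrite addnA.
apply/negP; rewrite econn_sym => /connectP[p].
case/shortenP => {}p pY pu _ lp.
have dX : d.1 \in X by rewrite (subsetP dYX) ?setU11.
(* With no edge on the path, [d] is a loop; with one edge, [d] repeats that edge; otherwise [d]
   closes a cycle. *)
have /(_ (s (flip d) :: p)) := acyc; case: p pY pu lp => [|x [|y p]] pY pu lp.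
- by have := noloop d; rewrite [s d]lp eqxx.
- move: pY lp; rewrite /= andbT => /eadjP[d' [d'Y d'd d'x]] xd.
  have d'E : flip d' = d by apply: nomulti; rewrite ?flipK // d'x.
  by rewrite -d'E d'Y in dY.
case/(_ isT pu)/negP; rewrite /cycle rcons_path -lp; apply/andP; split.
  apply: sub_path pY => a b /eadjP[d' [d'Y ? ?]]; apply/eadjP; exists d'.
  by split=> //; exact: (subsetP YX).
by apply/eadjP; exists d.
Qed.

(** Induction from the end of the walk. If the edge of [d] were assigned to the far end, that end
    would not be in [R], and the next step of the walk would be assigned to it as well; so the walk
    would turn back along the same edge. *)
Lemma assigned_walk X R m x p :
    assigned X R m -> #|X| + #|R| = #|U| ->
    walk s (fun d => s (flip d)) x p -> uniq (x :: [seq s (flip d) | d <- p]) ->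
    last x [seq s (flip d) | d <- p] \in R -> {in p, forall d, d.1 \in X} ->
  {in p, forall d, s d \notin R /\ m (s d) = d.1}.
Proof.
move=> mA cX; have mX' := assigned_image mA cX; case: mA => mX me mI.
elim: p x => // d p IH x /= /andP[/eqP dx wp] xp lR pX.
have [xd /andP[dp up]] := andP xp.
have {}IH : {in p, forall d', s d' \notin R /\ m (s d') = d'.1}.
  by apply: IH wp _ lR _; [rewrite /= dp | move=> d' d'p; rewrite pX // inE d'p orbT].
move=> d'; rewrite inE => /predU1P[{d'}->|]; last exact: IH.
have : d.1 \in m @: (~: R) by rewrite mX' pX ?mem_head.
case/imsetP=> w wR dw; have := me w wR; rewrite -dw => /existsP[b wb].
have := @eq_edge (d.1, b) d erefl; case=> db; rewrite db in wb.
  by rewrite (eqP wb) dw; rewrite inE in wR.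
have wR' := wR; rewrite inE in wR'; case/negP: wR'; rewrite -(eqP wb).
case: p {pX} wp xp lR dp up xd IH => [|d2 p] //= /andP[/eqP sd2 _] _ _ _ _ xd IH.
have [] := IH d2 (mem_head _ _); rewrite sd2 (eqP wb) -dw => _ dd2.
move: xd; rewrite -dx; have [dE|dE] := eq_edge dd2.
  by rewrite -sd2 -dE mem_head.
by rewrite dE flipK !inE eqxx orbT.
Qed.

(** * Cuts *)

Definition cut (A : {set U}) := [set e | (s (e, true) \in A) != (s (e, false) \in A)].

Lemma cutE A d : (d.1 \in cut A) = ((s d \in A) != (s (flip d) \in A)).
Proof. by case: d => e []; rewrite inE /flip //= eq_sym. Qed.

Lemma cut_econn X x d : d.1 \in X -> d.1 \notin cut [set y | econn X x y].
Proof.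
move=> dX; have := econn_edge dX; rewrite cutE !inE negbK => dc.
by rewrite [econn X x _]econn_sym (same_econn dc) [X in _ == X]econn_sym.
Qed.

End Multigraph.

(** * Planar duality *)

Section Planar.
Variable G : plane_graph.
Notation V := (vertex G).
Notation pc := (econn (@src G)).
Notation dc := (econn (@rface G)).

Lemma rface_rot (d : dart G) : rface (Defs.rot d) = rface (flip d).
Proof. by rewrite -{1}[d]flipK rface_next. Qed.

Lemma src_rot (d : dart G) : src (Defs.rot d) = src d.
Proof. by apply/esym/eqP; rewrite -rot_orbit fconnect1. Qed.

(* At each vertex the faces change an even number of times as one rotates, so
   the boundary of a set of faces is an even subgraph. *)
Lemma even_cut_cut (A : {set V}) (B : {set face G}) :
  ~~ odd #|cut (@src G) A :&: cut (@rface G) B|.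
Proof.
pose a (d : dart G) := src d \in A; pose b (d : dart G) := rface d \in B.
(* An edge with both ends in [A] contributes twice the same value, and an edge with one end in [A]
   contributes exactly when its two faces are separated by [B]. *)
have -> : odd #|cut (@src G) A :&: cut (@rface G) B| =
    \big[addb/false]_(e : edge G) \big[addb/false]_(c : bool)
      (a (e, c) && (b (e, c) (+) b (flip (e, c)))).
  rewrite -sum1_card (big_morph odd oddD (erefl _)) big_mkcond.
  apply: eq_bigr => e _; rewrite big_bool !inE /a /b /flip /=.
  by do 2!case: (_ \in A); do 2!case: (_ \in B).
rewrite (pair_bigA _ (fun e c => a (e, c) && (b (e, c) (+) b (flip (e, c))))) /=.
under eq_bigr => d _ do rewrite -surjective_pairing andb_addr.
(* [rot] keeps the source and carries the right face to the left face, so reindexing makes the two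
   sums equal. *)
rewrite big_split /= (reindex_inj (@Defs.rot_inj G)) /=.
rewrite -big_split big1 //= => d _.
by rewrite /a /b src_rot rface_rot addbb.
Qed.

(** If both connections failed, the cuts around the component of [src d] and around that of
    [rface d] would meet in the single edge of [d], against [even_cut_cut]. *)
Lemma planar_edge_dichotomy (d : dart G) (X : {set edge G}) : d.1 \notin X ->
  pc X (src d) (src (flip d)) || dc (~: (d.1 |: X)) (rface d) (rface (flip d)).
Proof.
move=> dX; apply/contraT; rewrite negb_or => /andP[npc ndc].
have := even_cut_cut [set y | pc X (src d) y]
  [set g | dc (~: (d.1 |: X)) (rface d) g].
rewrite (_ : _ :&: _ = [set d.1]) ?cards1 //; apply/setP => e.
rewrite in_set1 in_setI; have [-> {e}|ed] := eqVneq e d.1.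
  by rewrite !cutE !inE !econn0 (negPf npc) (negPf ndc).
have [eX|eX] := boolP (e \in X).
  by rewrite (negPf (@cut_econn _ _ (@src G) X (src d) (e, true) eX)).
have eX' : e \in ~: (d.1 |: X) by rewrite !inE negb_or ed.
by rewrite (negPf (@cut_econn _ _ (@rface G) _ (rface d) (e, true) eX')) andbF.
Qed.

End Planar.

Lemma n_comp1_connect (T : finType) (e : rel T) : connect_sym e ->
  n_comp e predT = 1 -> forall x y, connect e x y.
Proof.
move=> sym_e /eqP/card1P[r rP] x y; apply/(fingraph.rootP sym_e).
have rE z : fingraph.root e z = r.
  by apply/eqP; rewrite -[_ == r]rP !inE roots_root.
by rewrite !rE.
Qed.

Section PlanarConnected.
Variable G : plane_graph.
Notation V := (vertex G).
Notation Fc := (face G).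
Notation pc := (econn (@src G)).
Notation dc := (econn (@rface G)).
Implicit Types (d : dart G) (X Y : {set edge G}).

Lemma corner_closed (S : {set Fc}) (x : V) :
    (forall d, src d = x -> rface d \in S -> rface (flip d) \in S) ->
  forall d d', src d = x -> src d' = x -> rface d \in S -> rface d' \in S.
Proof.
move=> Sx d d' dx d'x.
have : fconnect (@Defs.rot G) d d' by rewrite rot_orbit dx d'x.
move/iter_findex => <-; elim: (findex _ _ _) => //= n IH /IH.
rewrite rface_rot => dS; apply: Sx => //.
by elim: (n) => //= k; rewrite src_rot.
Qed.

Lemma euler : #|V| + #|Fc| = #|edge G| + ncomp (@src G) setT + 1.
Proof.
rewrite (euler_formula (planar G)); congr (_ + _ + _).
apply: eq_n_comp => x y; apply: eq_connect => {}x {}y /=.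
by apply: eq_existsb => d; rewrite inE.
Qed.

Hypothesis G_conn : ncomp (@src G) setT = 1.

Lemma connectedP x y : pc setT x y.
Proof. exact: n_comp1_connect (@econn_sym _ _ _ _) G_conn x y. Qed.

Variable d0 : dart G.

Lemma vertex_dart x : exists d, src d = x.
Proof.
have [d /eqP <-|xd] := pickP [pred d : dart G | src d == x]; first by exists d.
have := connectedP x (src d0).
move/econn_closed => /(_ (pred1 x)); rewrite !inE eqxx => H.
by exists d0; apply/eqP/H => // d _; rewrite inE [src d == x]xd.
Qed.

(** A face without darts could only be incident to isolated vertices, and a connected graph with a
    dart has none. *)
Lemma face_dart g : exists d, rface d = g.
Proof.
have [d /eqP <-|gd] := pickP [pred d : dart G | rface d == g]; first by exists d.
have sym : symmetric (map_incidence_graph (@src G) (@rface G) (@iface G)).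
  by move=> [x|h] [y|k].
have /connectP[p] := n_comp1_connect (sym_connect_sym sym)
  (incidence_connected (planar G)) (inr g) (inl (src d0)).
case: p => [|[x|//] p] //= /andP[+ _] _.
case/orP => [/existsP[d /andP[_ dg]]|/andP[/forallP iso _]].
  by have := gd d; rewrite inE dg.
by have [d dx] := vertex_dart x; have := iso d; rewrite dx eqxx.
Qed.

Lemma dual_connected : ncomp (@rface G) setT = 1.
Proof.
pose S := [set g | dc setT (rface d0) g].
have Sx x : (forall d, src d = x -> rface d \in S -> rface (flip d) \in S).
  move=> d _; rewrite !inE => d0d.
  by apply: (econn_trans d0d); apply: (@econn_edge _ _ (@rface G) setT d); rewrite inE.
have allS : forall d, rface d \in S.
  (* The vertices all of whose corners lie in [S]. Adjacency preserves this, since [rot (flip d)]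
     starts at the other end of [d] and has the same right face. *)
  pose A : {set V} := [set x | [forall d : dart G, (src d == x) ==> (rface d \in S)]].
  suff AT x : x \in A.
    by move=> d; have := AT (src d); rewrite inE => /forallP/(_ d); rewrite eqxx.
  apply: (econn_closed (x := src d0) _ (connectedP _ _)) => [d _|].
    rewrite !inE => /forallP/(_ d); rewrite eqxx /= => dS.
    apply/forallP => d'; apply/implyP => /eqP d'd.
    apply: (corner_closed (Sx _) (d := Defs.rot (flip d))) d'd _.
      by rewrite src_rot.
    by rewrite rface_next.
  rewrite inE; apply/forallP => d; apply/implyP => /eqP dd0.
  by apply: (corner_closed (Sx _)) erefl dd0 _; rewrite inE econn0.
apply/eqP; rewrite eqn_leq; apply/andP; split.
  rewrite -(cards1 (rface d0)); apply: leq_ncomp => g.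
  exists (rface d0); first exact: set11.
  by have [d <-] := face_dart g; have := allS d; rewrite inE econn_sym.
by apply: leq_ltn_trans (@ltn_ncomp _ _ (@rface G) setT (rface d0) setT _ _); rewrite ?inE.
Qed.

(** The quantity [ncomp X + #|X|] minus the number of dual components of [~: X] does not decrease
    when an edge is added, by the dichotomy. By Euler's formula it has the same value at [set0] and
    at [setT], so it is constant. *)
Lemma planar_duality X :
  ncomp (@src G) X + #|X| + 1 = ncomp (@rface G) (~: X) + #|V|.
Proof.
have mono (Y Z : {set edge G}) : Y \subset Z -> ncomp (@src G) Y + #|Y| + ncomp (@rface G) (~: Z)
    <= ncomp (@src G) Z + #|Z| + ncomp (@rface G) (~: Y).
  apply: (sub_set_ind (P := fun Z => ncomp (@src G) Y + #|Y| +
    ncomp (@rface G) (~: Z) <= ncomp (@src G) Z + #|Z| + ncomp (@rface G) (~: Y))) => // {}Z d dZ.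
  rewrite (ncompU1 (@src G) Z d) (ncompU1 (@rface G) (~: (d.1 |: Z)) d).
  have -> : d.1 |: ~: (d.1 |: Z) = ~: Z.
    apply/setP => e; rewrite !inE negb_or.
    by case: eqP => //= ->; rewrite dZ.
  rewrite cardsU1 dZ; have /orP := planar_edge_dichotomy dZ.
  case=> -> /=.
    set b := ~~ _; move: (leq_b1 b); lia.
  set b := ~~ _; move: (leq_b1 b); lia.
have := mono _ _ (sub0set X); have := mono _ _ (subsetT X).
rewrite setCT setC0 !ncomp0 cards0 G_conn dual_connected cardsT.
have := euler; rewrite G_conn; lia.
Qed.

End PlanarConnected.

Section PlanarAssigned.
Variable G : plane_graph.
Notation V := (vertex G).
Notation Fc := (face G).
Notation pc := (econn (@src G)).
Notation dc := (econn (@rface G)).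
Implicit Types (d : dart G).

(* Otherwise the component [K] of [u] carries as many edges as vertices, hence
   encloses a nonempty set [S] of faces.  The vertices [A] and faces [S] inside
   are all assigned edges of [Y] inside, but Euler's formula makes [Y] too
   small. *)
Lemma planar_assigned_root (F D : {set edge G}) (RV : {set V}) (RF : {set Fc})
    (mV : V -> edge G) (mF : Fc -> edge G) (o : Fc) :
    ncomp (@src G) setT = 1 ->
    [disjoint F & D] ->
    assigned (@src G) F RV mV -> assigned (@rface G) D RF mF ->
    (forall g, g \in RF -> dc (~: F) o g) ->
    (forall x, x \in RV -> exists2 d, src d = x & dc (~: F) o (rface d)) ->
  forall u, exists2 r, r \in RV & pc F u r.
Proof.
move=> Gc FD [mVF mVe mVI] [mFD mFe mFI] oRF oRV u.
have [/exists_inP//|noR] := boolP [exists r in RV, pc F u r].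
exfalso; pose K := [set x | pc F u x].
have uK : u \in K by rewrite inE econn0.
have KR x : x \in K -> x \in ~: RV.
  rewrite !inE => ux; apply: contraNN noR => xR; apply/exists_inP; by exists x.
(* The edges of the component [K]. *)
pose O := [set e in F | src (e, true) \in K].
have OF : O \subset F by apply/subsetP => e; rewrite inE => /andP[].
have inO d : d.1 \in F -> (d.1 \in O) = (src d \in K).
  move=> dF; have := @econn_edge _ _ (@src G) F d dF; rewrite !inE dF /=.
  case: d dF => e [] //= eF; rewrite /flip /= => ec; rewrite -/(econn _ _ _ _).
  by apply/idP/idP => H; apply: econn_trans H _; rewrite // econn_sym.
have u_dart : exists d, src d = u.
  have := mVe u (KR _ uK); case/existsP=> b /eqP <-; by exists (mV u, b).
have [d0 d0u] := u_dart.
have KO : #|K| <= #|O|.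
  rewrite -(card_in_imset (D := K) (f := mV)) => [|x y /KR ? /KR ?]; last exact: mVI.
  apply/subset_leq_card/subsetP => _ /imsetP[x xK ->].
  have /existsP[b /eqP bx] := mVe x (KR _ xK).
  by rewrite (inO (mV x, b)) ?bx // mVF ?KR.
have ncO : #|~: K| < ncomp (@src G) O.
  apply: (ltn_ncomp uK) => d dO; by rewrite -inO ?(subsetP OF).
have dualO := planar_duality Gc d0 O.
(* The faces that [O] separates from [o]. There are some, because [O] has at least as many edges as
   [K] has vertices and [planar_duality] then gives a second dual component. *)
pose S := [set g | ~~ dc (~: O) o g].
have Scl d : d.1 \notin O -> rface d \in S -> rface (flip d) \in S.
  rewrite -in_setC => dO; rewrite !inE; apply: contraNN => H.
  by apply: (econn_trans H); rewrite econn_sym; exact: econn_edge.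
have Ssub g : dc (~: F) o g -> g \notin S.
  by move=> og; rewrite inE negbK; apply: econn_sub og; rewrite setCS.
have [g0 g0S] : exists g, g \in S.
  apply/set0Pn/negP => /eqP S0; have : ncomp (@rface G) (~: O) <= #|[set o]|.
    apply: leq_ncomp => g; exists o; rewrite ?set11 // econn_sym.
    have : g \notin S by rewrite S0 inE.
    by rewrite inE negbK.
  have := cardsC K; rewrite cards1; lia.
pose A := [set x | (x \notin K) && [forall d : dart G, (src d == x) ==> (rface d \in S)]].
have AP x d : x \in A -> src d = x -> rface d \in S.
  by rewrite inE => /andP[_ /forallP/(_ d)/implyP H] /eqP/H.
(* The edges inside the enclosed region; [mV] on [A] and [mF] on [S] take disjoint sets of values in
   it. *)
pose Y := [set e | [&& e \notin O, rface (e, true) \in S & rface (e, false) \in S]].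
have inY d : (d.1 \in Y) = [&& d.1 \notin O, rface d \in S & rface (flip d) \in S].
  by case: d => e []; rewrite inE /flip //= [X in _ && X]andbC.
have AR x : x \in A -> x \in ~: RV.
  move=> xA; rewrite inE; apply/negP => /oRV[d dx /Ssub/negP[]]; exact: AP dx.
have SR g : g \in S -> g \in ~: RF.
  by move=> gS; rewrite inE; apply: contraTN gS => /oRF/Ssub.
have AOn d : src d \in A -> d.1 \notin O.
  move=> dA; apply/negP => dO; have : src d \notin K by move: dA; rewrite inE => /andP[].
  by rewrite -inO ?dO ?(subsetP OF).
have AY : mV @: A \subset Y :&: F.
  apply/subsetP => _ /imsetP[x xA ->]; rewrite in_setI (mVF _ (AR _ xA)) andbT.
  have /existsP[b /eqP bx] := mVe x (AR _ xA).
  have dO := AOn (mV x, b); rewrite bx in dO.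
  have dS := AP x (mV x, b) xA bx.
  by rewrite (inY (mV x, b)) dS Scl ?dO.
have SY : mF @: S \subset Y :&: D.
  apply/subsetP => _ /imsetP[g gS ->]; rewrite in_setI (mFD _ (SR _ gS)) andbT.
  have /existsP[b /eqP bx] := mFe g (SR _ gS).
  have dO : (mF g, b).1 \notin O.
    apply: contraTN (mFD _ (SR _ gS)) => /(subsetP OF) H.
    by rewrite (disjointFr FD).
  have gS' : rface (mF g, b) \in S by rewrite bx.
  by rewrite (inY (mF g, b)) dO gS' Scl.
have cASY : #|A| + #|S| <= #|Y|.
  rewrite -(card_in_imset (D := A) (f := mV)) => [|x y /AR ? /AR ?]; last exact: mVI.
  rewrite -(card_in_imset (D := S) (f := mF)) => [|x y /SR ? /SR ?]; last exact: mFI.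
  apply: leq_trans (leq_add (subset_leq_card AY) (subset_leq_card SY)) _.
  rewrite -cardsUI -setIUr -setIIr -/(_ :&: _).
  rewrite (_ : F :&: D = set0) ?setI0 ?cards0 ?addn0; last first.
    by apply/eqP; rewrite setI_eq0.
  exact/subset_leq_card/subsetIl.
have ncY : #|~: S| < ncomp (@rface G) Y.
  by apply: (ltn_ncomp g0S) => d; rewrite inY => /and3P[].
have KOc x : x \in K -> pc (~: Y) u x.
  have OY : O \subset ~: Y by apply/subsetP => e eO; rewrite in_setC (inY (e, true)) eO.
  rewrite inE => ux; apply: econn_sub OY _.
  suff : x \in [set y | (y \in K) && pc O u y] by rewrite inE => /andP[].
  apply: econn_closed ux _ => [d dF|]; last by rewrite inE uK econn0.
  rewrite !inE => /andP[dK ud]; apply/andP; split.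
    exact: econn_trans dK (@econn_edge _ _ (@src G) F d dF).
  by apply: (econn_trans ud); apply: (@econn_edge _ _ (@src G)); rewrite inO // inE.
(* Without the edges of [Y], every vertex outside [A] is still joined to [u]. *)
have ncCY : ncomp (@src G) (~: Y) <= #|u |: A|.
  apply: leq_ncomp => x.
  have : x \in [set x | (x \in A) || pc (~: Y) u x].
    apply: econn_closed (connectedP Gc u x) _ => [d _|]; last by rewrite inE econn0 orbT.
    rewrite !(in_set (fun x => (x \in A) || _)).
    have [dY _|dY] := boolP (d.1 \in Y).
      have := dY; rewrite inY => /and3P[dO _ fdS].
      have [/KOc ->|fK] := boolP (src (flip d) \in K); first by rewrite orbT.
      rewrite [_ \in A]inE fK /=; apply/orP; left.
      apply/forallP => d'; apply/implyP => /eqP d'x.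
      apply: (corner_closed _ (erefl (src (flip d))) d'x fdS) => d2 d2x.
      apply: Scl; apply: contra fK => dO2.
      by rewrite -d2x -inO ?(subsetP OF).
    case/orP => [dA|ud]; last first.
      by rewrite (econn_trans ud) ?orbT //; apply: (@econn_edge _ _ (@src G)); rewrite inE.
    have dO := AOn d dA; have dS := AP _ d dA erefl.
    by rewrite inY dO dS Scl in dY.
  rewrite in_set => /orP[xA|ux]; [exists x | exists u]; rewrite ?econn0 ?setU11 //.
    by rewrite setU1r.
  by rewrite econn_sym.
(* Duality at [~: Y] and Euler's formula give [#|Y| < #|A| + #|S|], against [cASY]. *)
have dualY := planar_duality Gc d0 (~: Y); rewrite setCK in dualY.
have := euler G; rewrite Gc; have := cardsC Y; have := cardsC S; have := cardsC K.
have := cardsU1 u A; have := leq_b1 (u \notin A); lia.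
Qed.

End PlanarAssigned.

(** * The boundary of the unbounded face *)

Lemma subseq_index (T : eqType) (x0 : T) (s t : seq T) : subseq s t ->
  exists f : nat -> nat,
    (forall i, i < size s -> f i < size t /\ nth x0 t (f i) = nth x0 s i)
    /\ (forall i j, i < j -> j < size s -> f i < f j).
Proof.
elim: t s => [|y t IH] [|x s] //=; try by exists id.
case: eqP => [<-|_] /IH[f [fP fM]].
  exists (fun i => if i is i'.+1 then (f i').+1 else 0); split=> [[|i] //=|[|i] [|j] //= ij js].
    by rewrite ltnS => /fP[].
  exact: fM.
exists (fun i => (f i).+1); split=> [i /fP[]|i j ij js] //.
by rewrite ltnS fM.
Qed.

Lemma uniq_map_inj (T1 T2 : eqType) (f : T1 -> T2) (s : seq T1) :
  uniq (map f s) -> {in s &, injective f}.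
Proof.
elim: s => //= x s IH /andP[fx /IH{}IH] y z; rewrite !inE.
case/predU1P=> [->|ys] /predU1P[->|zs] // fyz; last exact: IH.
  by rewrite fyz map_f in fx.
by rewrite -fyz map_f in fx.
Qed.

Section Configuration.
Variables (G : plane_graph) (n : nat).
Notation N := n.*2.+1.
Variables (v v' : 'I_N -> vertex G).
Hypothesis v'_path : sorted (@adj G) (codom v') /\ uniq (codom v').
Hypothesis v_order : ccw_on_outer (codom v ++ seq.rev (codom v')).
Hypothesis v_deg : forall x, x \in smashed v v' -> deg x = 2.
Hypothesis v_faces : uniq (outer G :: map (@smash_face G) (smashed v v')).

Notation pc := (econn (@src G)).
Notation dc := (econn (@rface G)).
Notation S0 := (smashed v v').
Implicit Types (d : dart G) (x : vertex G) (k : 'I_N) (u : 'I_N -> vertex G)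
  (A : {set vertex G}) (F : {set edge G}).

Lemma smashedP x :
  reflect (exists2 k : 'I_N, odd k & x = v k \/ x = v' k) (x \in S0).
Proof.
rewrite mem_cat; apply: (iffP orP) => [[]/mapP[k]|[k ok [->|->]]].
- by rewrite mem_filter => /andP[ok _] ->; exists k; auto.
- by rewrite mem_filter => /andP[ok _] ->; exists k; auto.
- by left; apply/mapP; exists k; rewrite // mem_filter ok mem_enum.
- by right; apply/mapP; exists k; rewrite // mem_filter ok mem_enum.
Qed.

Lemma smashed_uniq : uniq S0.
Proof. by case/andP: v_faces => _ /map_uniq. Qed.

Lemma smash_face_inj : {in S0 &, injective (@smash_face G)}.
Proof.
case/andP: v_faces => _ uf x y xS yS; exact: (uniq_map_inj uf).
Qed.

Lemma smash_face_outer x : x \in S0 -> smash_face x != outer G.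
Proof.
case/andP: v_faces => /negP nf _ xS; apply/eqP => xo; case: nf; rewrite -xo.
exact: map_f.
Qed.

Lemma card_odd_ord : count (fun k : 'I_N => odd k) (enum 'I_N) = n.
Proof.
rewrite -(count_map val odd) val_enum_ord.
by elim: n => // m IH; rewrite doubleS -addn2 iotaD count_cat IH /= odd_double addn1.
Qed.

Lemma size_smashed : size S0 = n.*2.
Proof. by rewrite size_cat !size_map !size_filter card_odd_ord addnn. Qed.

Notation s := (codom v ++ seq.rev (codom v')).

Lemma size_s : size s = N.*2.
Proof. by rewrite size_cat size_rev !size_codom card_ord addnn. Qed.

Lemma nth_codom_ord x0 u k : nth x0 (codom u) k = u k.
Proof. by rewrite codomE (nth_map k) ?size_enum_ord // nth_ord_enum. Qed.

Lemma nth_s_v x0 k : nth x0 s k = v k.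
Proof.
by rewrite nth_cat size_codom card_ord ltn_ord nth_codom_ord.
Qed.

Lemma nth_s_v' x0 k : nth x0 s (N.*2 - k.+1) = v' k.
Proof.
have kN := ltn_ord k.
rewrite nth_cat size_codom card_ord ifN; last by lia.
rewrite nth_rev ?size_codom ?card_ord; last by lia.
rewrite (_ : N - _ = k); last by lia.
exact: nth_codom_ord.
Qed.

(** [f i] is a time at which the boundary walk from [d0] is at the [i]-th entry of [s]. Times are
    recorded because the walk may visit a vertex more than once. *)
Definition outer_positions (d0 : dart G) (f : nat -> nat) :=
  [/\ rface d0 = outer G,
      forall i, i < N.*2 -> f i < order (@face_next G) d0 /\
        src (iter (f i) (@face_next G) d0) = nth (src d0) s i
    & forall i j, i < j -> j < N.*2 -> f i < f j].

Lemma outer_positions_exist : exists d0 f, outer_positions d0 f.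
Proof.
case: v_order => d0 d0o /(subseq_index (src d0))[f [fP fM]].
exists d0, f; split=> // [i|i j ij]; rewrite -size_s => si; last exact: fM.
have [] := fP i si; rewrite size_map size_orbit => fio <-; split=> //.
by rewrite (nth_map d0) ?size_orbit // nth_traject.
Qed.

Lemma rface_iter d0 i : rface (iter i (@face_next G) d0) = rface d0.
Proof. by elim: i => //= i IH; rewrite rface_next. Qed.

Lemma src_face_next d : src (face_next d) = src (flip d).
Proof. exact: src_rot. Qed.

Lemma s_outer x : x \in s -> exists2 d, src d = x & rface d = outer G.
Proof.
have [d0 [f [d0o fP _]]] := outer_positions_exist.
move=> xs; have ix : index x s < N.*2 by rewrite -size_s index_mem.
have [_] := fP _ ix; rewrite nth_index // => dx.
by exists (iter (f (index x s)) (@face_next G) d0); rewrite // rface_iter.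
Qed.

Lemma v_in_s k : v k \in s.
Proof. by rewrite mem_cat codom_f. Qed.

Lemma v'_in_s k : v' k \in s.
Proof. by rewrite mem_cat mem_rev codom_f orbT. Qed.

Lemma smashed_in_s x : x \in S0 -> x \in s.
Proof. by case/smashedP => k _ [->|->]; [exact: v_in_s | exact: v'_in_s]. Qed.

(** Of the two darts at a smashed vertex, [d1] has the unbounded face on its right and [d2] has it
    on its left, because [rot] exchanges them. *)
Lemma smash_darts x : x \in S0 -> exists d1 d2 : dart G,
  [/\ src d1 = x /\ src d2 = x,
      rface d1 = outer G /\ rface (flip d1) = smash_face x,
      rface d2 = smash_face x /\ rface (flip d2) = outer G,
      d1.1 != d2.1
    & forall d, src d = x -> d = d1 \/ d = d2].
Proof.
move=> xS; have fo := smash_face_outer xS.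
have [d1 d1x d1o] := s_outer (smashed_in_s xS).
have [d2 d2x d2f] : exists2 d2, src d2 = x & rface d2 = smash_face x.
  move: fo; rewrite /smash_face; case: pickP => [g|_]; last by rewrite eqxx.
  case/andP=> go /orP[/existsP[d2 /andP[/eqP d2x /eqP d2g]] _|]; first by exists d2.
  by case/andP => /forallP/(_ d1); rewrite d1x eqxx.
have d12 : d1 != d2 by apply: contraNneq fo => d12; rewrite -d2f -d12 d1o.
have dE d : src d = x -> d = d1 \/ d = d2.
  move=> dx; have : d \in [set d : dart G | src d == x] by rewrite inE dx.
  suff -> : [set d : dart G | src d == x] = [set d1; d2] by move/set2P.
  apply/esym/eqP; rewrite eqEcard -/(deg x) v_deg // cards2 d12 andbT.
  by apply/subsetP => d'; rewrite !inE => /orP[]/eqP ->; apply/eqP.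
(* A dart fixed by [rot] would be the only one at [x]. *)
have rotN d : src d = x -> Defs.rot d != d.
  move=> dx; apply/eqP => rd; have : fconnect (@Defs.rot G) d d1.
    by rewrite rot_orbit dx d1x.
  have : fconnect (@Defs.rot G) d d2 by rewrite rot_orbit dx d2x.
  have fx d' : fconnect (@Defs.rot G) d d' -> d' = d.
    by move/iter_findex => <-; elim: (findex _ _ _) => //= m ->.
  by move=> /fx d2d /fx d1d; rewrite d1d d2d eqxx in d12.
have r1 : Defs.rot d1 = d2.
  by have [e|] := dE (Defs.rot d1) (etrans (src_rot _) d1x); first have /eqP := rotN d1 d1x.
have r2 : Defs.rot d2 = d1.
  by have [|e] := dE (Defs.rot d2) (etrans (src_rot _) d2x); last have /eqP := rotN d2 d2x.
exists d1, d2; split=> //; first by rewrite -rface_rot r1.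
  by rewrite -rface_rot r2.
apply/eqP => /eq_edge[d12'|d12']; first by rewrite d12' eqxx in d12.
by have := no_loop d2; rewrite -d12' d1x d2x eqxx.
Qed.

Lemma smash_edge_faces d : src d \in S0 ->
  rface d = outer G /\ rface (flip d) = smash_face (src d)
  \/ rface d = smash_face (src d) /\ rface (flip d) = outer G.
Proof.
move=> dS; have [d1 [d2 [_ [d1o d1f] [d2f d2o] _ /(_ d erefl)]]] := smash_darts dS.
case=> dE; [left | right]; split; move: d1o d1f d2f d2o; rewrite -dE //.
Qed.

(** An edge at a smashed vertex has the unbounded face on one side, so two adjacent smashed vertices
    would share their bounded face. *)
Lemma smash_edge_other d : src d \in S0 -> src (flip d) \notin S0.
Proof.
move=> dS; apply/negP => fdS; have := smash_edge_faces dS.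
have := smash_edge_faces fdS; rewrite flipK => H1 H2.
have ? := smash_face_outer dS; have ? := smash_face_outer fdS.
have : smash_face (src d) = smash_face (src (flip d)).
  case: H1 => -[e1 e2]; case: H2 => -[e3 e4]; congruence.
by move/(smash_face_inj dS fdS)/esym/eqP; rewrite (negPf (no_loop d)).
Qed.

Definition E0 : {set edge G} := edges_within (G0_verts v v').

Lemma in_E0 d : (d.1 \in E0) = (src d \notin S0) && (src (flip d) \notin S0).
Proof.
case: d => e b; rewrite inE; apply/forallP/andP => [H|[H1 H2] c].
  by have := H b; have := H (~~ b); rewrite !inE.
by rewrite inE; case: b c H1 H2 => [] [].
Qed.

Lemma E0PnP d : d.1 \notin E0 -> src d \in S0 \/ src (flip d) \in S0.
Proof. by rewrite in_E0 negb_and !negbK => /orP. Qed.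

Lemma smash_edge d : src d \in S0 -> d.1 \notin E0.
Proof. by move=> dS; rewrite in_E0 dS. Qed.

Definition smash_edges (A : {set vertex G}) : {set edge G} :=
  [set d.1 | d : dart G & src d \in A].

Lemma smash_edgesP A d :
  reflect (src d \in A \/ src (flip d) \in A) (d.1 \in smash_edges A).
Proof.
apply: (iffP imsetP) => [[d']|[dA|dA]].
- by rewrite inE => d'A /eq_edge[->|->]; rewrite ?flipK; auto.
- by exists d; rewrite ?inE.
- by exists (flip d); rewrite ?inE.
Qed.

Lemma E0C : ~: E0 = smash_edges [set x in S0].
Proof.
apply/setP => e; rewrite in_setC -[e]/((e, true).1) in_E0 negb_and !negbK.
by apply/orP/smash_edgesP; rewrite !inE.
Qed.

Lemma card_smash_edges (A : {set vertex G}) : {subset A <= S0} ->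
  #|smash_edges A| = #|A|.*2.
Proof.
move=> AS; rewrite card_in_imset => [|d d']; last first.
  rewrite !inE => /AS dS /AS d'S /eq_edge[//|dd'].
  by have := smash_edge_other d'S; rewrite -dd' dS.
rewrite -sum1_card (partition_big (@src G) (mem A)) => [|d]; last by rewrite inE.
rewrite (eq_bigr (fun=> 2)) => [|x xA].
  by rewrite sum_nat_const -[RHS]muln2.
rewrite sum1dep_card -(v_deg (AS _ xA)) /deg; apply: eq_card => d.
by rewrite !inE andb_idl // => /eqP ->.
Qed.

Lemma card_smashed : #|[set x in S0]| = n.*2.
Proof. by rewrite cardsE (card_uniqP smashed_uniq) size_smashed. Qed.

Lemma card_E0 : #|E0| + n.*2.*2 = #|edge G|.
Proof.
rewrite -card_smashed -card_smash_edges ?(eq_sym _ #|edge G|) => [|x].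
  by rewrite -E0C cardsC.
by rewrite inE.
Qed.

Lemma outer_dart_uniq d d' : src d \in S0 -> src d' = src d ->
  rface d = outer G -> rface d' = outer G -> d' = d.
Proof.
move=> dS d'd; have fo := smash_face_outer dS.
have [d1 [d2 [_ [d1o d1f] [d2f d2o] _ dE]]] := smash_darts dS.
have [->|->] := dE d erefl; have [->|->] := dE d' d'd; rewrite ?d1o ?d2f // => e1 e2;
  by move: fo; rewrite ?e1 ?e2 eqxx.
Qed.

Lemma inner_dart_uniq d d' : src d \in S0 -> src d' = src d ->
  rface (flip d) = outer G -> rface (flip d') = outer G -> d' = d.
Proof.
move=> dS d'd; have fo := smash_face_outer dS.
have [d1 [d2 [_ [d1o d1f] [d2f d2o] _ dE]]] := smash_darts dS.
have [->|->] := dE d erefl; have [->|->] := dE d' d'd; rewrite ?d1f ?d2o // => e1 e2;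
  by move: fo; rewrite ?e1 ?e2 eqxx.
Qed.

(* Only one of the two corners of a smashed vertex lies in the unbounded face. *)
Lemma smashed_position d0 f i q : outer_positions d0 f ->
    i < order (@face_next G) d0 -> q < N.*2 ->
    src (iter i (@face_next G) d0) \in S0 ->
    src (iter i (@face_next G) d0) = nth (src d0) s q ->
  i = f q.
Proof.
case=> d0o fP _ iL qN iS iq; have [fL fq] := fP q qN.
have dd : iter (f q) (@face_next G) d0 = iter i (@face_next G) d0.
  by apply: outer_dart_uniq; rewrite ?rface_iter // fq.
apply/eqP; rewrite -(nth_uniq d0 _ _ (orbit_uniq (@face_next G) d0)) ?size_orbit //.
by rewrite !nth_traject // dd.
Qed.

(** The walk passes the outer corner of a smashed vertex only once. This keeps smashed vertices
    apart from the even-indexed ones and from one another. *)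
Lemma smashed_index x0 q q' : q < N.*2 -> q' < N.*2 ->
  nth x0 s q \in S0 -> nth x0 s q' = nth x0 s q -> q' = q.
Proof.
move=> qN q'N qS qq'; have [d0 [f pf]] := outer_positions_exist.
have qS' : nth (src d0) s q \in S0 by rewrite (set_nth_default x0) // size_s.
have qq0 : nth (src d0) s q' = nth (src d0) s q.
  by rewrite !(set_nth_default x0 (src d0)) ?size_s.
have [_ fP fM] := pf; have [fL fq] := fP q qN.
have ff : f q = f q'.
  by apply: (smashed_position pf) => //; rewrite fq ?qq0.
by case: (ltngtP q q') => [/fM/(_ q'N)|/fM/(_ qN)|->] //; rewrite ff ltnn.
Qed.

Lemma v_even k : ~~ odd k -> v k \notin S0.
Proof.
move=> ek; apply/negP => /[dup] kS /smashedP[j oj]; have kN := ltn_ord k.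
have jN := ltn_ord j; case=> e.
  have := @smashed_index (v k) k j; rewrite !nth_s_v -e => /(_ _ _ kS erefl) H.
  by move: oj; rewrite H ?(negPf ek) //; lia.
have := @smashed_index (v k) k (N.*2 - j.+1); rewrite nth_s_v nth_s_v' -e.
by move=> /(_ _ _ kS erefl) H; lia.
Qed.

Lemma v'_even k : ~~ odd k -> v' k \notin S0.
Proof.
move=> ek; apply/negP => /[dup] kS /smashedP[j oj]; have kN := ltn_ord k.
have jN := ltn_ord j; case=> e.
  have := @smashed_index (v' k) (N.*2 - k.+1) j.
  by rewrite nth_s_v nth_s_v' -e => /(_ _ _ kS erefl) H; lia.
have := @smashed_index (v' k) (N.*2 - k.+1) (N.*2 - j.+1).
rewrite !nth_s_v' -e => /(_ _ _ kS erefl) H.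
by move: oj; rewrite (_ : j = k) ?(negPf ek) //; apply: val_inj => /=; lia.
Qed.

(** * Arcs of the boundary between consecutive entries *)

Section Arcs.
Variable F : {set edge G}.
Hypothesis F_outer : forall d, rface d = outer G -> d.1 \in E0 ->
  pc F (src d) (src (flip d)).

Lemma outer_segment d0 a b : rface d0 = outer G -> a <= b ->
    (forall i, a <= i <= b -> src (iter i (@face_next G) d0) \notin S0) ->
  pc F (src (iter a (@face_next G) d0)) (src (iter b (@face_next G) d0)).
Proof.
move=> d0o /subnK <-; elim: (b - a) => [|m IH] nS; first exact: econn0.
apply: econn_trans (IH _) _ => [i /andP[ai im]|].
  by apply: nS; rewrite ai addSn ltnW.
rewrite addSn iterS src_face_next; apply: F_outer; first by rewrite rface_iter.
rewrite in_E0 nS; last by rewrite addSn leqnSn leq_addl.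
by rewrite -src_face_next -iterS nS // addSn leqnn -addSn leq_addl.
Qed.

(** All smashed vertices occur in [s], each at a single time of the walk, so none is met between two
    consecutive entries. *)
Lemma between_positions d0 f q i : outer_positions d0 f -> q.+1 < N.*2 ->
  f q < i < f q.+1 -> src (iter i (@face_next G) d0) \notin S0.
Proof.
move=> pf qN /andP[qi iq]; apply/negP => iS.
have [_ fP fM] := pf; have [fL _] := fP _ qN.
have := smashed_in_s iS => is_.
have ix : index (src (iter i (@face_next G) d0)) s < N.*2 by rewrite -size_s index_mem.
have iE := smashed_position pf (ltn_trans iq fL) ix iS (esym (nth_index _ is_)).
move: ix iE; set q' := index _ _ => q'N iE.
have [q'q|] := ltnP q' q.
  by have := fM _ _ q'q (ltnW qN); rewrite -iE ltnNge ltnW.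
rewrite leq_eqVlt => /predU1P[qq'|]; first by rewrite iE -qq' ltnn in qi.
rewrite leq_eqVlt => /predU1P[qq'|/fM/(_ q'N)]; first by rewrite iE -qq' ltnn in iq.
by rewrite -iE ltnNge ltnW.
Qed.

Lemma outer_arc x0 q : q.+1 < N.*2 -> nth x0 s q \notin S0 ->
  nth x0 s q.+1 \notin S0 -> pc F (nth x0 s q) (nth x0 s q.+1).
Proof.
have [d0 [f pf]] := outer_positions_exist; have [d0o fP fM] := pf.
move=> qN; rewrite !(set_nth_default (src d0) x0) ?size_s ?(ltnW qN) //.
have [_ <-] := fP _ (ltnW qN); have [_ <-] := fP _ qN => qS qS'.
apply: outer_segment => // [|i]; first exact/ltnW/fM.
rewrite leq_eqVlt => /andP[/predU1P[<- //|qi]].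
rewrite leq_eqVlt => /predU1P[-> //|iq].
by apply: (between_positions pf qN); rewrite qi.
Qed.

(** [d] is the dart by which the walk leaves the smashed vertex, so the arc starts one step
    later. *)
Lemma outer_arc_after x0 q d : q.+1 < N.*2 -> nth x0 s q \in S0 ->
    nth x0 s q.+1 \notin S0 -> src d = nth x0 s q -> rface d = outer G ->
  pc F (src (flip d)) (nth x0 s q.+1).
Proof.
have [d0 [f pf]] := outer_positions_exist; have [d0o fP fM] := pf.
move=> qN; rewrite !(set_nth_default (src d0) x0) ?size_s ?(ltnW qN) //.
have [_ <-] := fP _ (ltnW qN); have [_ <-] := fP _ qN => qS qS' dq do_.
have -> : d = iter (f q) (@face_next G) d0.
  by apply: outer_dart_uniq; rewrite ?rface_iter.
rewrite -src_face_next -iterS.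
apply: outer_segment => // [|i]; first exact/fM.
move=> /andP[qi]; rewrite leq_eqVlt => /predU1P[-> //|iq].
by apply: (between_positions pf qN); rewrite qi.
Qed.

(** Here [flip d] is the dart by which the walk enters the smashed vertex, so the arc ends one step
    earlier. *)
Lemma outer_arc_before x0 q d : q.+1 < N.*2 -> nth x0 s q \notin S0 ->
    nth x0 s q.+1 \in S0 -> src d = nth x0 s q.+1 -> rface (flip d) = outer G ->
  pc F (nth x0 s q) (src (flip d)).
Proof.
have [d0 [f pf]] := outer_positions_exist; have [d0o fP fM] := pf.
move=> qN; rewrite !(set_nth_default (src d0) x0) ?size_s ?(ltnW qN) //.
have [_ <-] := fP _ (ltnW qN); have [_ <-] := fP _ qN => qS qS' dq do_.
have := fM q q.+1 (ltnSn q) qN; move: qS' dq; case fq: (f q.+1) => [|m] // mS dm qm.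
have -> : d = flip (iter m (@face_next G) d0).
  by apply: inner_dart_uniq; rewrite -?src_face_next // flipK rface_iter.
rewrite flipK; apply: outer_segment => // i.
rewrite leq_eqVlt => /andP[/predU1P[<- //|qi] im].
by apply: (between_positions pf qN); rewrite qi fq.
Qed.

End Arcs.

Lemma smashed_face_conn x : x \in S0 -> dc (~: E0) (outer G) (smash_face x).
Proof.
move=> xS; have [d1 [_ [[d1x _] [<- <-] _ _ _]]] := smash_darts xS.
by apply: econn_edge; rewrite inE smash_edge // d1x.
Qed.

(** * Root sets *)

Lemma card_odd : #|[set k : 'I_N | odd k]| = n.
Proof. by rewrite cardsE -sum1_card -[RHS]card_odd_ord -sum1_count big_enum_cond. Qed.

Lemma card_even : #|[set k : 'I_N | ~~ odd k]| = n.+1.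
Proof.
have := cardsC [set k : 'I_N | odd k]; rewrite card_odd card_ord.
rewrite (_ : ~: _ = [set k : 'I_N | ~~ odd k]); last by apply/setP=> k; rewrite !inE.
by rewrite -addnn; lia.
Qed.

(** Forests of G_0 are viewed on all vertices of G, where each smashed vertex is a tree by itself
    and hence its own root. *)
Definition primal_roots : {set vertex G} :=
  [set x in S0] :|: [set v' k | k in [set k : 'I_N | ~~ odd k]].

(** z and the faces at the smashed [u k]. The matching prescribes the roots for [u := v']; the same
    dual forest is also studied with [u := v]. *)
Definition dual_roots (u : 'I_N -> vertex G) : {set face G} :=
  outer G |: [set smash_face (u k) | k in [set k : 'I_N | odd k]].

Lemma v'_inj : injective v'.
Proof. by apply/injectiveP; case: v'_path. Qed.

Lemma v_odd_inj k j : odd k -> v j = v k -> j = k.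
Proof.
move=> ok; have kN := ltn_ord k; have jN := ltn_ord j.
have kS : v k \in S0 by apply/smashedP; exists k; auto.
have := @smashed_index (v k) k j; rewrite !nth_s_v => H /H/val_inj; apply => //; lia.
Qed.

Lemma v_smashed k : odd k -> v k \in S0.
Proof. by move=> ok; apply/smashedP; exists k; auto. Qed.

Lemma v'_smashed k : odd k -> v' k \in S0.
Proof. by move=> ok; apply/smashedP; exists k; auto. Qed.

Lemma primal_rootP x : reflect (x \in S0 \/ exists2 k : 'I_N, ~~ odd k & x = v' k)
  (x \in primal_roots).
Proof.
rewrite !inE; apply: (iffP orP) => -[]; auto.
  by case/imsetP => k; rewrite inE => ek ->; right; exists k.
by case=> k ek ->; right; apply: imset_f; rewrite inE.
Qed.

Lemma primal_root_v' k : v' k \in primal_roots.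
Proof.
apply/primal_rootP; have [ok|ek] := boolP (odd k); last by right; exists k.
by left; exact: v'_smashed.
Qed.

Lemma card_primal_roots : #|primal_roots| = n.*2 + n.+1.
Proof.
rewrite cardsU card_smashed (card_imset _ v'_inj) card_even.
rewrite (_ : _ :&: _ = set0) ?cards0 ?subn0 //; apply/setP => x; rewrite !inE.
apply/andP => -[xS /imsetP[k]]; rewrite inE => /v'_even + xk.
by rewrite -xk xS.
Qed.

Lemma dual_rootP u g : reflect (g = outer G \/ exists2 k : 'I_N, odd k & g = smash_face (u k))
  (g \in dual_roots u).
Proof.
rewrite !inE; apply: (iffP orP) => -[].
- by move/eqP; auto.
- by case/imsetP => k; rewrite inE => ok ->; right; exists k.
- by move=> ->; rewrite eqxx; auto.
- by case=> k ok ->; right; apply: imset_f; rewrite inE.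
Qed.

Lemma card_dual_roots u : (forall k, odd k -> u k \in S0) ->
  {in [set k : 'I_N | odd k] &, injective u} -> #|dual_roots u| = n.+1.
Proof.
move=> uS uI; rewrite cardsU1 card_in_imset ?card_odd => [|k j]; last first.
  move=> ok oj /smash_face_inj kj; apply: uI => //; move: ok oj kj.
  by rewrite !inE => ok oj; apply; exact: uS.
rewrite (_ : outer G \notin _) //; apply/imsetP => -[k]; rewrite inE => ok /esym/eqP.
by rewrite (negPf (smash_face_outer (uS _ ok))).
Qed.

Lemma card_dual_roots_v : #|dual_roots v| = n.+1.
Proof.
by apply: card_dual_roots v_smashed _ => k j _; rewrite inE => oj; exact: v_odd_inj.
Qed.

Lemma card_dual_roots_v' : #|dual_roots v'| = n.+1.
Proof. by apply: card_dual_roots v'_smashed _ => k j _ _; exact: v'_inj. Qed.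

Lemma v'_adj k (j : 'I_N) : k.+1 = j :> nat -> exists2 d, src d = v' k & src (flip d) = v' j.
Proof.
move=> kj; have jN := ltn_ord j; case: v'_path => /(sortedP (v' k)) + _.
rewrite size_codom card_ord => /(_ k); rewrite kj => /(_ jN).
rewrite !nth_codom_ord => /existsP[d].
by case/and3P => _ /eqP dk /eqP dj; exists d.
Qed.

Lemma smash_dart_inj d d' : src d \in S0 -> src d' \in S0 -> d.1 = d'.1 -> d = d'.
Proof.
move=> dS d'S /eq_edge[//|dd'].
by have := smash_edge_other d'S; rewrite -dd' dS.
Qed.

Lemma v_neq_v' k (j : 'I_N) : odd k -> v k != v' j.
Proof.
move=> ok; apply/eqP => kj; have kN := ltn_ord k; have jN := ltn_ord j.
have := @smashed_index (v k) k (N.*2 - j.+1); rewrite nth_s_v nth_s_v' -kj.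
by move=> /(_ _ _ (v_smashed ok) erefl) H; lia.
Qed.

Lemma leq_double_self m : m <= m.*2.
Proof. by rewrite -addnn leq_addr. Qed.

(** * From matchings to forests *)

Section Matched.
Variables (F : {set edge G}) (mV : vertex G -> edge G) (mF : face G -> edge G).
Notation D := (E0 :\: F).
Hypotheses (F_E0 : F \subset E0)
  (mV_assigned : assigned (@src G) F primal_roots mV)
  (mF_assigned : assigned (@rface G) D (dual_roots v') mF)
  (card_F : #|F| + #|primal_roots| = #|vertex G|)
  (card_D : #|D| + #|dual_roots v'| = #|face G|).

(** The two cardinalities add up to [#|V| + #|F| = #|E| + 2], so Euler's formula leaves a single
    component. *)
Lemma matched_connected : ncomp (@src G) setT = 1.
Proof.
have := euler G; rewrite -card_F -card_D card_primal_roots card_dual_roots_v'.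
have := cardsID F E0; rewrite (setIidPr F_E0); have := card_E0; rewrite -!addnn; lia.
Qed.

(** [planar_assigned_root] applies because all roots lie on the unbounded face, and the root faces
    are joined to it across edges outside [E0]. *)
Lemma matched_primal_rooted : rooted (@src G) F primal_roots.
Proof.
have E0F : ~: E0 \subset ~: F by rewrite setCS.
split=> //; apply: (planar_assigned_root (o := outer G) matched_connected _
  mV_assigned mF_assigned).
- by rewrite disjoint_sym disjoints_subset setDE subsetIr.
- move=> g /dual_rootP[->|[k ok ->]]; first exact: econn0.
  exact: econn_sub E0F (smashed_face_conn (v'_smashed ok)).
move=> x /primal_rootP xR; have [|d dx do_] := s_outer (x := x).
  by case: xR => [/smashed_in_s //|[k _ ->]]; exact: v'_in_s.
by exists d; rewrite // do_ econn0.
Qed.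

Lemma smashed_isolated x y : x \in S0 -> pc F x y -> y = x.
Proof.
move=> xS xy; apply/set1P; apply: econn_closed xy (set11 x) => d dF /set1P dx.
by have := subsetP F_E0 _ dF; rewrite in_E0 dx xS.
Qed.

Lemma primal_root_inj k (j : 'I_N) : pc F (v' k) (v' j) -> k = j.
Proof.
move=> kj; apply: v'_inj.
by apply: (rooted_roots matched_primal_rooted) kj; exact: primal_root_v'.
Qed.

Definition v'_edges : {set edge G} := smash_edges [set v' k | k in [set k : 'I_N | odd k]].

Lemma v'_edges_connect k : pc (F :|: v'_edges) (v' k) (v' ord0).
Proof.
case: k => m; elim: m => [|m IH] mN.
  by rewrite (_ : Ordinal _ = ord0) ?econn0 //; exact: val_inj.
have mN' := ltnW mN; apply: econn_trans (IH mN'); rewrite econn_sym.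
have [d dk dj] := @v'_adj (Ordinal mN') (Ordinal mN) erefl.
rewrite -dk -dj; apply: (@econn_edge _ _ (@src G)); rewrite inE; apply/orP; right.
apply/smash_edgesP; rewrite dk dj.
have [om|em] := boolP (odd m); [left|right]; apply: imset_f; rewrite inE //=.
Qed.

(** Adding [v'_edges] to [F] leaves at most [n.+1] components, so the dual of the complement is
    connected. That dual consists of [D] and of edges at the [v k] with [k] odd, which only join z
    to the faces [smash_face (v k)]; hence each component of [D] contains a root. *)
Lemma matched_dual_rooted_v : rooted (@rface G) D (dual_roots v).
Proof.
split; last by rewrite card_dual_roots_v -card_dual_roots_v'.
pose X1 := F :|: v'_edges.
have v'S : {subset [set v' k | k in [set k : 'I_N | odd k]] <= S0}.
  by move=> x /imsetP[k]; rewrite inE => ok ->; exact: v'_smashed.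
have cX1 : #|X1| = #|F| + n.*2.
  rewrite cardsU (_ : F :&: _ = set0) ?cards0 ?subn0.
    by rewrite card_smash_edges // (card_imset _ v'_inj) card_odd.
  apply/setP => e; rewrite in_set0 in_setI; apply/andP => -[/(subsetP F_E0)].
  have /subsetP sub : v'_edges \subset ~: E0.
    by apply/subsetP => e' /imsetP[d]; rewrite inE => /v'S dS ->; rewrite inE smash_edge.
  by move=> eE /sub; rewrite inE eE.
have ncX1 : ncomp (@src G) X1 <= n.+1.
  pose R1 := v' ord0 |: [set v k | k in [set k : 'I_N | odd k]].
  apply: (@leq_trans #|R1|).
    apply: leq_ncomp => x; have [r rR xr] := matched_primal_rooted.1 x.
    have xr1 : pc X1 x r by apply: econn_sub xr; exact: subsetUl.
    have [k rk] : exists k, r = v' k \/ odd k /\ r = v k.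
      case/primal_rootP: rR => [/smashedP[k ok [->|->]]|[k _ ->]]; exists k; auto.
    case: rk xr1 => [->|[ok ->]] xr1; last first.
      by exists (v k); rewrite // setU1r // imset_f // inE.
    exists (v' ord0); first exact: setU11.
    by apply: (econn_trans xr1); exact: v'_edges_connect.
  rewrite cardsU1; apply: (leq_add (leq_b1 _)).
  by apply: leq_trans (leq_imset_card _ _) _; rewrite card_odd.
have [d0 [_ [d0o _ _]]] := outer_positions_exist.
have ncD : ncomp (@rface G) (~: X1) = 1.
  have := planar_duality matched_connected d0 X1.
  have := @ltn_ncomp _ _ (@rface G) setT (outer G) (~: X1) (in_setT _) (fun d _ => in_setT _).
  rewrite cX1 -card_F card_primal_roots; move: ncX1; lia.
move=> g; pose T := [set g | [exists r in dual_roots v, dc D g r]].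
suff : g \in T by rewrite inE => /exists_inP.
have conn := n_comp1_connect (@econn_sym _ _ (@rface G) (~: X1)) ncD.
have RT r : r \in dual_roots v -> r \in T.
  by move=> rR; rewrite inE; apply/exists_inP; exists r; rewrite ?econn0.
apply: econn_closed (conn (outer G) g) (RT _ (setU11 _ _)) => d.
rewrite !inE negb_or => /andP[dF dv'] /exists_inP[r rR dr].
have [dE|dE] := boolP (d.1 \in E0).
  apply/exists_inP; exists r => //; apply: econn_trans dr; rewrite econn_sym.
  by apply: econn_edge; rewrite inE dF.
have fR d' : d'.1 = d.1 -> src d' \in S0 ->
    rface d' \in dual_roots v /\ rface (flip d') \in dual_roots v.
  move=> d'd d'S; have [k ok d'k] : exists2 k : 'I_N, odd k & src d' = v k.
    case/smashedP: (d'S) => k ok [->|d'k]; first by exists k.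
    case/negP: dv'; rewrite -d'd; apply/smash_edgesP; left.
    by rewrite d'k imset_f // inE.
  by case: (smash_edge_faces d'S) => -[-> ->]; rewrite d'k; split;
    apply/dual_rootP; auto; right; exists k.
have fR' : rface (flip d) \in dual_roots v.
  have [dS|dS] := E0PnP dE; first by have [] := fR d erefl dS.
  by have [] := fR (flip d) erefl dS.
by have := RT _ fR'; rewrite inE.
Qed.

(** The assignment of edges to faces exchanges the roots at [v] for those at [v']. *)
Lemma matched_dual_rooted : rooted (@rface G) D (dual_roots v').
Proof. exact: assigned_rooted matched_dual_rooted_v mF_assigned card_D. Qed.

Lemma smash_face_not_outer x : x \in S0 -> ~~ dc D (smash_face x) (outer G).
Proof.
move=> xS; apply/negP => xo; case/negP: (smash_face_outer xS); apply/eqP.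
have oR u : outer G \in dual_roots u by exact: setU11.
case/smashedP: (xS) xo => k ok [->|->] xo.
  apply: (rooted_roots matched_dual_rooted_v _ _ xo) => //.
  by apply/dual_rootP; right; exists k.
apply: (rooted_roots matched_dual_rooted _ _ xo) => //.
by apply/dual_rootP; right; exists k.
Qed.

(* If the ends of an outer edge were not connected by [F], its two faces would
   be connected by the other dual edges. *)
Lemma matched_outer d : rface d = outer G -> d.1 \in E0 ->
  pc F (src d) (src (flip d)).
Proof.
move=> do_ dE; have [dF|dF] := boolP (d.1 \in F); first exact: (@econn_edge _ _ (@src G)).
have dD : d.1 \in D by rewrite inE dF.
have /orP[//|] := planar_edge_dichotomy dF; rewrite econn_sym => fd.
have := rooted_bridge matched_dual_rooted dD; rewrite econn_sym => /negP[].
suff : rface d \in [set g | dc (D :\ d.1) (rface (flip d)) g] by rewrite inE.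
apply: econn_closed fd _ => [d'|]; last by rewrite inE econn0.
rewrite !inE negb_or => /andP[d'd d'F] dd'.
have [d'E|d'E] := boolP (d'.1 \in E0).
  by apply: (econn_trans dd'); apply: econn_edge; rewrite in_setD1 in_setD d'd d'F.
(* A path leaving [D] would do so at z or at a smashed face. The first makes [d] a non-bridge; the
   second joins a smashed face to z inside [D], through [d]. *)
exfalso; have : exists2 x, x \in S0 & rface d' = smash_face x \/ rface d' = outer G.
  case: (E0PnP d'E) => [d'S|d'S].
    by exists (src d') => //; case: (smash_edge_faces d'S) => -[-> _]; [right | left].
  exists (src (flip d')) => //; have := smash_edge_faces d'S; rewrite flipK.
  by case=> -[_ ->]; [left | right].
case=> x xS [d'x|d'o]; last first.
  by case/negP: (rooted_bridge matched_dual_rooted dD); rewrite econn_sym do_ -d'o.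
case/negP: (smash_face_not_outer xS); rewrite -d'x -do_.
apply: (@econn_trans _ _ _ _ (rface (flip d))); last first.
  by rewrite econn_sym; exact: econn_edge.
by rewrite econn_sym; apply: econn_sub dd'; exact: subsetDl.
Qed.

(** The tree contains one root of [dual_roots v] and one of [dual_roots v'], and these are the two
    given faces. *)
Lemma dual_link_classes k (j : 'I_N) x : odd k -> odd j ->
    dc D (smash_face (v k)) (smash_face (v' j)) -> x \in S0 ->
  dc D (smash_face (v k)) (smash_face x) = (x == v k) || (x == v' j).
Proof.
move=> ok oj kj xS; apply/idP/idP => [kx|/orP[]/eqP-> //]; last exact: econn0.
have inR u (i : 'I_N) : odd i -> smash_face (u i) \in dual_roots u.
  by move=> oi; apply/dual_rootP; right; exists i.
apply/orP; case/smashedP: (xS) kx => i oi [] -> {x xS} ki; [left|right]; apply/eqP.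
  apply: smash_face_inj; rewrite ?v_smashed //.
  by apply: (rooted_roots matched_dual_rooted_v); rewrite ?inR // econn_sym.
apply: smash_face_inj; rewrite ?v'_smashed //.
apply: (rooted_roots matched_dual_rooted); rewrite ?inR //.
by apply: econn_trans kj; rewrite econn_sym.
Qed.

(* Parity of the intersection of the boundary of the component of
   [smash_face (v k)] with the cut defined by the tree of [y]. *)
Lemma link_parity k (j : 'I_N) (ds : seq (dart G)) y : odd k -> odd j ->
    dc D (smash_face (v k)) (smash_face (v' j)) -> y \notin S0 ->
    uniq ds -> (forall d, (d \in ds) = (src d == v k) || (src d == v' j)) ->
  ~~ odd (count (fun d => pc F y (src (flip d))) ds).
Proof.
move=> ok oj kj yS uds dsE.
pose A := [set x | pc F y x]; pose Q := [set g | dc D (smash_face (v k)) g].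
have dsS d : d \in ds -> src d \in S0.
  by rewrite dsE => /orP[]/eqP->; rewrite ?v_smashed ?v'_smashed.
pose es := [seq d.1 | d <- ds & pc F y (src (flip d))].
have ues : uniq es.
  rewrite map_inj_in_uniq ?filter_uniq // => d d'; rewrite !mem_filter.
  by move=> /andP[_ /dsS dS] /andP[_ /dsS d'S]; exact: smash_dart_inj.
have := even_cut_cut A Q; rewrite -size_filter -(size_map fst) -/es -(card_uniqP ues).
rewrite (@eq_card _ _ (mem es)) // => e; rewrite in_setI.
(* Edges of [F] avoid the first cut and those of [D] the second, so only edges at smashed vertices
   can lie in both. *)
suff H d : src d \in S0 -> (d.1 \in cut (@src G) A) && (d.1 \in cut (@rface G) Q) = (d.1 \in es).
  have [eE|eE] := boolP (e \in E0); last first.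
    by have [dS|dS] := E0PnP (d := (e, true)) eE; exact: H dS.
  transitivity false.
    have [eF|eF] := boolP (e \in F).
      by rewrite (negPf (@cut_econn _ _ (@src G) F y (e, true) eF)).
    have eD : e \in D by rewrite in_setD eF.
    by rewrite (negPf (@cut_econn _ _ (@rface G) D _ (e, true) eD)) andbF.
  apply/esym/mapP => -[d]; rewrite mem_filter => /andP[_ /dsS/smash_edge/negP dE] ed.
  by case: dE; rewrite -ed.
move=> dS; have srcA : src d \notin A.
  rewrite inE; apply: contraNN yS; rewrite econn_sym.
  by move/(smashed_isolated dS) => ->.
have outQ : outer G \notin Q by rewrite inE smash_face_not_outer // v_smashed.
have -> : (d.1 \in cut (@src G) A) = (src (flip d) \in A).
  by rewrite cutE (negPf srcA); case: (_ \in A).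
have -> : (d.1 \in cut (@rface G) Q) = (smash_face (src d) \in Q).
  by rewrite cutE; case: (smash_edge_faces dS) => -[-> ->]; rewrite (negPf outQ) //;
    case: (_ \in Q).
have -> : (smash_face (src d) \in Q) = (d \in ds) by rewrite inE (dual_link_classes ok oj) // dsE.
apply/andP/mapP => [[dA dds]|[d']].
  by exists d; rewrite // mem_filter dds andbT; rewrite inE in dA.
rewrite mem_filter => /andP[d'A d'ds] /(smash_dart_inj dS (dsS _ d'ds)) ->.
by rewrite inE.
Qed.

(* [link2] rules out [j = k + 2] because distinct [smash_face (v _)] are not
   connected. *)
Lemma link_step k (km kp : 'I_N) : km.+1 = k :> nat -> k.+1 = kp :> nat -> odd k ->
    pc F (v kp) (v' kp) ->
    (forall i : 'I_N, i = k.+2 :> nat -> dc D (smash_face (v i)) (smash_face (v' i))) ->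
  dc D (smash_face (v k)) (smash_face (v' k)) /\ pc F (v km) (v' km).
Proof.
move=> kmk kkp ok vkp link2; have kN := ltn_ord k; have kpN := ltn_ord kp.
have [r rR kr] := matched_dual_rooted.1 (smash_face (v k)).
have [j oj kj] : exists2 j : 'I_N, odd j & dc D (smash_face (v k)) (smash_face (v' j)).
  case/dual_rootP: rR kr => [->|[j oj ->]]; last by exists j.
  by rewrite (negPf (smash_face_not_outer (v_smashed ok))).
have jN := ltn_ord j.
have jmN : j.-1 < N by rewrite (leq_ltn_trans (leq_pred j)).
have jpN : j.+1 < N.
  rewrite ltnS ltn_neqAle -ltnS jN andbT; apply: contraTneq oj => ->.
  by rewrite odd_double.
pose jm := Ordinal jmN; pose jp := Ordinal jpN.
have jm1 : jm.+1 = j :> nat by rewrite /= prednK // odd_gt0.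
have jmp : jm != jp by rewrite -val_eqE /= neq_ltn ltnS leq_pred.
have [dm dmj dmm] : exists2 d, src d = v' j & src (flip d) = v' jm.
  by have [d ? ?] := @v'_adj jm j jm1; exists (flip d); rewrite ?flipK.
have [dp dpj dpp] := @v'_adj j jp erefl.
(* Along the boundary, [db] leads on to [v kp] and [da] leads back to [v km]. *)
have [db [da [[dbk dak] [dbo _] [_ dao] dba dbaE]]] := smash_darts (v_smashed ok).
have dmp : dm != dp.
  by apply: contraNneq jmp => e; apply/eqP/v'_inj; rewrite -dmm e.
have dmpE d : src d = v' j -> d = dm \/ d = dp.
  move=> dj; have [d1 [d2 [_ _ _ _ dE]]] := smash_darts (v'_smashed oj).
  have := dE _ dj; have := dE _ dmj; have := dE _ dpj.
  case=> ep [] em [] e; first [by left; rewrite e em | by right; rewrite e ep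
    | by case/eqP: dmp; rewrite em ep].
pose ds := [:: db; da; dm; dp].
have dsE d : (d \in ds) = (src d == v k) || (src d == v' j).
  rewrite !inE; apply/or4P/orP => [[]/eqP->|[/eqP/dbaE|/eqP/dmpE]].
  - by rewrite dbk; left.
  - by rewrite dak; left.
  - by rewrite dmj; right.
  - by rewrite dpj; right.
  - by case=> ->; [constructor 1 | constructor 2].
  by case=> ->; [constructor 3 | constructor 4].
have nkj := v_neq_v' j ok.
have dN d d' : src d = v k -> src d' = v' j -> d != d'.
  by move=> dk d'j; apply: contraNneq nkj => dd'; rewrite -dk dd' d'j.
have uds : uniq ds.
  rewrite /= !inE !negb_or (dN _ _ dbk dmj) (dN _ _ dbk dpj) (dN _ _ dak dmj).
  rewrite (dN _ _ dak dpj) dmp !andbT.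
  by apply: contraNneq dba => ->.
have ev x (xS : x \notin S0) := link_parity ok oj kj xS uds dsE.
have em : ~~ odd jm by rewrite /= -oddS prednK ?odd_gt0 // oj.
have ep : ~~ odd jp by rewrite /= oj.
have inj i i' : i != i' -> pc F (v' i) (v' i') = false.
  by move=> ii'; apply/negP => /primal_root_inj/eqP; rewrite (negPf ii').
have bkp : pc F (src (flip db)) (v' kp).
  apply: econn_trans vkp; have := @outer_arc_after _ matched_outer (v k) k db.
  rewrite kkp !nth_s_v => ->; rewrite ?(v_smashed ok) //.
    exact: leq_trans kpN (leq_double_self _).
  by apply: v_even; rewrite -kkp /= ok.
have kma : pc F (v km) (src (flip da)).
  have := @outer_arc_before _ matched_outer (v k) km da.
  rewrite kmk !nth_s_v => ->; rewrite ?(v_smashed ok) //.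
    exact: leq_trans kN (leq_double_self _).
  by apply: v_even; rewrite -oddS kmk ok.
(* Of the neighbours [v' jm] and [v' jp], only the first is in the tree of [v' jm]; by parity
   exactly one neighbour of [v k] is in it too. *)
have pm : pc F (v' jm) (src (flip db)) (+) pc F (v' jm) (src (flip da)).
  have := ev _ (v'_even em); rewrite [count _ _]/= dmm dpp econn0 (inj _ _ jmp).
  by case: (pc _ _ _); case: (pc _ _ _).
have pp : pc F (v' jp) (src (flip db)) (+) pc F (v' jp) (src (flip da)).
  have := ev _ (v'_even ep); rewrite [count _ _]/= dmm dpp econn0 inj 1?eq_sym //.
  by case: (pc _ _ _); case: (pc _ _ _).
(* If that neighbour is the one beyond [v k], then [jm = kp], so [j] is [k + 2], which [link2]
   excludes. Otherwise [jp = kp] and [j = k]. *)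
have [pb|npb] := boolP (pc F (v' jm) (src (flip db))).
  have /primal_root_inj jkp : pc F (v' jm) (v' kp) := econn_trans pb bkp.
  have jk2 : j = k.+2 :> nat by rewrite -jm1 jkp kkp.
  have := link2 j jk2; rewrite econn_sym => /(econn_trans kj).
  have inR (i : 'I_N) : odd i -> smash_face (v i) \in dual_roots v.
    by move=> oi; apply/dual_rootP; right; exists i.
  move/(rooted_roots matched_dual_rooted_v (inR _ ok) (inR _ oj)).
  move/(smash_face_inj (v_smashed ok) (v_smashed oj))/esym/(v_odd_inj ok) => jk.
  by move/eqP: jk2; rewrite jk ltn_eqF // ltnS leqnSn.
have pa : pc F (v' jm) (src (flip da)) by rewrite (negPf npb) in pm.
have npa : ~~ pc F (v' jp) (src (flip da)).
  apply: contraFN (inj _ _ jmp) => ja; apply: econn_trans pa _; by rewrite econn_sym.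
have {pp}pb : pc F (v' jp) (src (flip db)) by rewrite (negPf npa) addbF in pp.
have /primal_root_inj jkp : pc F (v' jp) (v' kp) := econn_trans pb bkp.
have jk : j = k by apply: val_inj; move: (congr1 val jkp); rewrite /= -kkp => -[].
split; first by rewrite -{2}jk.
have kmjm : km = jm by apply: val_inj; rewrite /= jk -kmk.
rewrite kmjm in kma *.
by rewrite econn_sym in pa; exact: econn_trans kma pa.
Qed.

(** Induction on [m], going backward from the last index. For [m = 0] the second claim is void, as
    its index is out of range, and the first holds because the last [v] and the last [v'] are
    consecutive in [s]. *)
Lemma links m : m <= n ->
  (forall k, k = (n - m).*2 :> nat -> pc F (v k) (v' k)) /\
  (forall k, k = (n - m).*2.+1 :> nat -> dc D (smash_face (v k)) (smash_face (v' k))).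
Proof.
elim: m => [_|m IH mn].
  rewrite subn0; split=> k kE; last by have := ltn_ord k; rewrite kE ltnn.
  have -> : k = ord_max by apply: val_inj.
  have eN : ~~ odd (@ord_max n.*2) by rewrite /= odd_double.
  have e1 : nth (v k) s n.*2 = v ord_max := nth_s_v _ ord_max.
  have e2 : nth (v k) s n.*2.+1 = v' ord_max.
    rewrite -(nth_s_v' (v k)) /=; congr (nth _ _ _); by rewrite -(addnn N) addnK.
  have := @outer_arc _ matched_outer (v k) n.*2; rewrite e1 e2; apply.
  - by rewrite -(addnn N) -[X in X < _]addn0 ltn_add2l.
  - exact: v_even.
  exact: v'_even.
have [pcm dcm] := IH (ltnW mn); have i1 : n - m = (n - m.+1).+1 by rewrite subnSK.
rewrite i1 in pcm dcm; move: (n - m.+1) i1 pcm dcm => i i1 pcm dcm.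
have iN : i.*2.+2 < N by rewrite ltnS -doubleS -i1 leq_double leq_subr.
have H := @link_step (Ordinal (ltnW iN)) (Ordinal (ltnW (ltnW iN))) (Ordinal iN) erefl erefl.
have [] := H _ _ _.
- by rewrite /= odd_double.
- exact: pcm.
- by move=> k kE; apply: dcm; rewrite kE.
by move=> dcH pcH; split=> k kE;
  [rewrite (_ : k = Ordinal (ltnW (ltnW iN))) | rewrite (_ : k = Ordinal (ltnW iN))] => //;
  apply: val_inj.
Qed.

Lemma link_even k : ~~ odd k -> pc F (v k) (v' k).
Proof.
move=> ek; have kn : k./2 <= n by rewrite -leq_double even_halfK // -ltnS.
have [+ _] := links (leq_subr k./2 n); apply.
by rewrite subKn // even_halfK.
Qed.

Lemma link_odd k : odd k -> dc D (smash_face (v k)) (smash_face (v' k)).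
Proof.
move=> ok; have kn : k./2 <= n.
  by rewrite -leq_double odd_halfK // -ltnS prednK ?odd_gt0 // ltnW.
have [_] := links (leq_subr k./2 n); apply.
by rewrite subKn // odd_halfK // prednK // odd_gt0.
Qed.

End Matched.

(** * Channels as components of the dual forest *)

Lemma separatesE d : separates d.1 =
  [&& rface d != outer G, rface (flip d) != outer G & rface d != rface (flip d)].
Proof.
case: d => e [] //; rewrite /separates /flip /= [rface (e, true) == rface _]eq_sym.
by case: (rface (e, true) != _); case: (rface (e, false) != _).
Qed.

Lemma separates_E0 e : separates e -> e \in E0.
Proof.
rewrite -[e]/((e, true).1); apply: contraTT => eE; rewrite separatesE.
have [dS|dS] := E0PnP eE; have := smash_edge_faces dS; rewrite ?flipK.
  by case=> -[-> ->]; rewrite eqxx ?andbF.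
by case=> -[-> ->]; rewrite eqxx ?andbF.
Qed.

Lemma dual_adj_econn F g h : connect (dual_adj F) g h -> dc (E0 :\: F) g h.
Proof.
apply: connect_sub => {}g {}h /existsP[d /and4P[dF /separates_E0 dE /eqP <- /eqP <-]].
by apply: econn_edge; rewrite in_setD dF.
Qed.

(** Besides dual edges at z, [dual_adj] omits only edges with the same face on both sides, which
    connect nothing. *)
Lemma econn_dual_adj F g h : ~~ dc (E0 :\: F) g (outer G) -> dc (E0 :\: F) g h ->
  connect (dual_adj F) g h.
Proof.
move=> go gh; suff : h \in [set h | connect (dual_adj F) g h] by rewrite inE.
apply: econn_closed gh _ => [d dD|]; last by rewrite inE connect0.
rewrite !inE => gd; have gd' := dual_adj_econn gd.
have [<- //|dd'] := eqVneq (rface d) (rface (flip d)).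
apply: connect_trans gd (connect1 _); apply/existsP; exists d.
have := dD; rewrite in_setD => /andP[-> _]; rewrite separatesE dd' !eqxx !andbT /=.
apply/andP; split; first by apply: contraNneq go => <-.
apply: contraNneq go => <-.
exact: econn_trans gd' (@econn_edge _ _ (@rface G) _ d dD).
Qed.

(** The [n.*2] smashed vertices are isolated in [F]. *)
Lemma n_comp_G0 F : F \subset E0 ->
  ncomp (@src G) F = n_comp (adj_in F) (G0_verts v v') + n.*2.
Proof.
move=> FE; rewrite /ncomp (n_compC (mem (G0_verts v v'))); congr (_ + _).
rewrite -card_smashed; apply: eq_card => x; rewrite !inE negbK andbC.
apply: andb_idr => xS; apply/eqP.
exact: (smashed_isolated FE xS (connect_root _ x)).
Qed.

Lemma adj_z_smash x : x \in S0 -> adj_z (smash_face x).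
Proof.
move=> xS; have [_ [d2 [_ _ [d2f d2o] _ _]]] := smash_darts xS.
apply/andP; split; first exact: smash_face_outer.
by apply/existsP; exists d2; rewrite d2f [lface _]d2o !eqxx.
Qed.

Lemma matched_forest F mV mF : F \subset E0 ->
    assigned (@src G) F primal_roots mV ->
    assigned (@rface G) (E0 :\: F) (dual_roots v') mF ->
    #|F| + #|primal_roots| = #|vertex G| ->
    #|E0 :\: F| + #|dual_roots v'| = #|face G| ->
  forest v v' F.
Proof.
move=> FE mVA mFA cF cD; have rF := matched_primal_rooted FE mVA mFA cF cD.
split.
- split=> // c; exact: rooted_acyclic rF.
- apply/eqP; rewrite -(eqn_add2r n.*2) -n_comp_G0 //.
  by rewrite (rooted_ncomp rF) card_primal_roots addnC.
- move=> j k _ _; apply: contraNN => jk; apply/eqP.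
  exact: (primal_root_inj FE mVA mFA cF cD jk).
- by move=> k ek; exact: (link_even FE mVA mFA cF cD).
move=> k ok; exists [set h | connect (dual_adj F) (smash_face (v k)) h]; last first.
  rewrite !inE connect0; split=> //; apply: econn_dual_adj.
    exact: (smash_face_not_outer FE mVA mFA cF cD (v_smashed ok)).
  exact: (link_odd FE mVA mFA cF cD).
split; first by exists (smash_face (v k)); rewrite // smash_face_outer ?v_smashed.
exists (smash_face (v k)), (smash_face (v' k)).
rewrite !inE connect0 !adj_z_smash ?v_smashed ?v'_smashed //; split=> //.
  apply: econn_dual_adj.
    exact: (smash_face_not_outer FE mVA mFA cF cD (v_smashed ok)).
  exact: (link_odd FE mVA mFA cF cD).
apply/eqP => e; case/eqP: (v_neq_v' k ok); apply: smash_face_inj e.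
  exact: v_smashed.
exact: v'_smashed.
Qed.

(** * From forests to matchings *)

Section Forest.
Variable F : {set edge G}.
Hypothesis F_forest : forest v v' F.

Lemma forest_E0 : F \subset E0.
Proof. by case: F_forest => -[]. Qed.

Lemma forest_primal_rooted : rooted (@src G) F primal_roots.
Proof.
have [[FE acyc] nc rr _ _] := F_forest.
have ncF : ncomp (@src G) F = #|primal_roots|.
  by rewrite n_comp_G0 // [n_comp _ _]nc card_primal_roots addnC.
split; last first.
  rewrite -ncF addnC; apply: acyclic_ncomp acyc; first exact: no_loop.
  exact: no_multiple_edge.
apply: ncomp_roots; rewrite ?ncF // => r r' /primal_rootP rR /primal_rootP r'R rr'.
case: rR => [rS|[k ek rE]]; first by rewrite (smashed_isolated FE rS rr').
case: r'R => [r'S|[j ej r'E]].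
  by rewrite econn_sym in rr'; rewrite (smashed_isolated FE r'S rr').
rewrite rE r'E; have [->//|kj] := eqVneq k j.
by have := rr k j ek ej kj; rewrite [connect _ _ _](_ : _ = true) // -rE -r'E.
Qed.

(** [F] joins each vertex of G_0 to some [v' k], the path through the [v'] joins these, and each
    smashed vertex has a neighbour in G_0. *)
Lemma forest_connected : ncomp (@src G) setT = 1.
Proof.
have FT := subsetT F.
have v'0 k : pc setT (v' k) (v' ord0).
  by apply: econn_sub (v'_edges_connect F k); exact: subsetT.
have G0c x : x \notin S0 -> pc setT x (v' ord0).
  move=> xS; have [r /primal_rootP rR xr] := forest_primal_rooted.1 x.
  apply: econn_trans (econn_sub FT xr) _; case: rR => [rS|[k _ ->]] //.
  rewrite econn_sym in xr; have := smashed_isolated forest_E0 rS xr.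
  by move=> xr'; rewrite xr' rS in xS.
apply/eqP; rewrite eqn_leq; apply/andP; split.
  rewrite -(cards1 (v' ord0)); apply: leq_ncomp => x; exists (v' ord0); rewrite ?set11 //.
  have [xS|] := boolP (x \in S0); last exact: G0c.
  have [d [_ [[dx _] _ _ _ _]]] := smash_darts xS.
  apply: econn_trans (G0c (src (flip d)) _); last by rewrite smash_edge_other // dx.
  by rewrite -dx; apply: (@econn_edge _ _ (@src G)); rewrite inE.
by apply: leq_ltn_trans (@ltn_ncomp _ _ (@src G) setT (v' ord0) setT _ _); rewrite ?inE.
Qed.

(** As [F] is acyclic, the dual of its complement is connected. Its edges outside [E0] only join z
    to smashed faces, and a channel joins each [smash_face (v k)] to the root
    [smash_face (v' k)]. *)
Lemma forest_dual_rooted : rooted (@rface G) (E0 :\: F) (dual_roots v').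
Proof.
have [d0 [_ [d0o _ _]]] := outer_positions_exist.
have rF := forest_primal_rooted; have cF := rF.2.
split; last first.
  have := euler G; rewrite forest_connected card_dual_roots_v' -cF card_primal_roots.
  have := cardsID F E0; rewrite (setIidPr forest_E0); have := card_E0.
  rewrite -!addnn; lia.
have nc1 : ncomp (@rface G) (~: F) = 1.
  have := planar_duality forest_connected d0 F; rewrite (rooted_ncomp rF) -cF; lia.
move=> g; suff : g \in [set g | [exists r in dual_roots v', dc (E0 :\: F) g r]].
  by rewrite inE => /exists_inP.
have conn := n_comp1_connect (@econn_sym _ _ (@rface G) (~: F)) nc1 (outer G) g.
have outR : outer G \in dual_roots v' := setU11 _ _.
apply: econn_closed conn _ => [d|]; last first.
  by rewrite inE; apply/exists_inP; exists (outer G); rewrite ?econn0.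
rewrite !inE => dF /exists_inP[r rR dr]; apply/exists_inP.
have [dE|dE] := boolP (d.1 \in E0).
  exists r => //; apply: econn_trans dr; rewrite econn_sym.
  by apply: econn_edge; rewrite in_setD dF.
have fR x : x \in S0 -> exists2 r, r \in dual_roots v' & dc (E0 :\: F) (smash_face x) r.
  case/smashedP => k ok xk; exists (smash_face (v' k)).
    by apply/dual_rootP; right; exists k.
  case: xk => [->|->]; last exact: econn0.
  have [_ _ _ _ /(_ k ok)[C [[g1 _ ->] _] []]] := F_forest.
  rewrite !inE => /dual_adj_econn g1v /dual_adj_econn; apply: econn_trans.
  by rewrite econn_sym.
have [dS|dS] := E0PnP dE; have := smash_edge_faces dS; rewrite ?flipK.
  case=> -[_ ->]; first exact: fR.
  by exists (outer G); rewrite ?econn0.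
case=> -[-> _]; last exact: fR.
by exists (outer G); rewrite ?econn0.
Qed.

End Forest.

(** * The bijection *)

Notation cell := (vertex G + face G)%type.
Notation W := (hat_verts v v' :\: [set terminal v' k | k : 'I_N]).

Lemma mem_foldl_smash (S : {set hvert G}) (r : seq (vertex G)) p :
  (p \in foldl (@smash G) S r) =
  (p \in S) && all (fun x => (p != ov x) && ~~ hadj (ov x) p) r.
Proof.
elim: r S => [|x r IH] S /=; first by rewrite andbT.
by rewrite IH /smash !inE negb_or -!andbA; case: (p \in S); rewrite ?andbF.
Qed.

Lemma terminalP p : reflect (exists2 k : 'I_N,
    p = if odd k then fv (smash_face (v' k)) else ov (v' k) & true)
  (p \in [set terminal v' k | k : 'I_N]).
Proof.
by apply: (iffP imsetP) => -[k]; [move=> _ -> | move=> -> _]; exists k.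
Qed.

Lemma mem_W_ov x : (ov x \in W) = (x \notin primal_roots).
Proof.
rewrite in_setD /hat_verts mem_foldl_smash !inE /=.
have -> : all (fun y => (ov x != ov y) && true) S0 = (x \notin S0).
  apply/allP/idP => [H|xS y yS].
    by apply/negP => /H; rewrite eqxx.
  by rewrite andbT; apply: contraNneq xS => -[->].
rewrite andbC negb_or; congr (_ && ~~ _); apply/terminalP/imsetP.
  case=> k; case: ifP => // /negbT ek [xk] _.
  by exists k; rewrite ?inE.
by case=> k; rewrite inE => /negPf ek ->; exists k; rewrite ?ek.
Qed.

Lemma mem_W_fv g : (fv g \in W) = (g \notin dual_roots v').
Proof.
rewrite in_setD /hat_verts mem_foldl_smash !inE /=.
have -> : all (fun y => (fv g != ov y) && true) S0.
  exact/allP.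
rewrite andbT andbC negb_or; congr (~~ _ && ~~ _).
apply/terminalP/imsetP.
  case=> k; case: ifP => // ok [gk] _.
  by exists k; rewrite ?inE.
by case=> k; rewrite inE => ok ->; exists k; rewrite ?ok.
Qed.

Lemma mem_W_ev e : (ev e \in W) = (e \in E0).
Proof.
rewrite in_setD /hat_verts mem_foldl_smash !inE /=.
have -> : ev e \notin [set terminal v' k | k : 'I_N].
  by apply/terminalP => -[k]; case: ifP.
apply/allP/forallP => [H b|H x xS].
  rewrite inE; apply/negP => /H /existsP[]; by exists b.
by apply/existsP => -[b /eqP xb]; have := H b; rewrite inE xb xS.
Qed.

Definition matched_edges (M : {set {set hvert G}}) : {set edge G} :=
  [set e | [exists x, [set ov x; ev e] \in M]].

(** [e0] is the value where [a] has no partner. *)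
Definition mate (e0 : edge G) (M : {set {set hvert G}}) (a : cell) : edge G :=
  odflt e0 [pick e | [set inl a; inr e] \in M].

Section Matching.
Variables (M : {set {set hvert G}}) (e0 : edge G).
Hypothesis M_matching : matching v v' M.

Lemma matching_mem (A : {set hvert G}) : A \in M -> exists a e,
  [/\ inl a \in W, ev e \in W, hinc e a & A = [set inl a; inr e]].
Proof.
move: M_matching => /perfect_matchingP[ME _] /ME[[a|e] [[a'|e'] [xW yW _ h AE]]] //.
  by exists a, e'.
by exists a', e; rewrite setUC.
Qed.

Lemma matching_uniq p (A B : {set hvert G}) : A \in M -> B \in M -> p \in A -> p \in B -> A = B.
Proof.
move=> AM BM pA pB; have pW : p \in W.
  by have [a [e [aW eW _ AE]]] := matching_mem AM; move: pA; rewrite AE => /set2P[]->.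
by have /perfect_matchingP[_ /(_ p pW)[C [_ _ CU]]] := M_matching; rewrite (CU A) // (CU B).
Qed.

Lemma matching_inl_uniq a a' e : [set inl a; inr e] \in M ->
  [set inl a'; inr e] \in M -> a = a'.
Proof.
move=> aM a'M; have := matching_uniq aM a'M (set22 _ _) (set22 _ _).
by move/set2_inl_inr => [].
Qed.

Lemma matching_inr_uniq a e e' : [set inl a; inr e] \in M ->
  [set inl a; inr e'] \in M -> e = e'.
Proof.
move=> aM a'M; have := matching_uniq aM a'M (set21 _ _) (set21 _ _).
by move/set2_inl_inr => [].
Qed.

Lemma mateP a : inl a \in W -> [set inl a; inr (mate e0 M a)] \in M.
Proof.
move=> aW; rewrite /mate; case: pickP => [e //|noe].
have /perfect_matchingP[_ /(_ _ aW)[A [AM aA _]]] := M_matching.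
have [a' [e [_ _ _ AE]]] := matching_mem AM.
have aE : a = a' by move: aA; rewrite AE => /set2P[[]|].
by have := noe e; rewrite aE -AE AM.
Qed.

Lemma mate_uniq a e : [set inl a; inr e] \in M -> mate e0 M a = e.
Proof.
move=> aM; apply: (matching_inr_uniq (mateP _) (aM)).
have [a' [e' [aW _ _ /set2_inl_inr[-> _]]]] := matching_mem aM; exact: aW.
Qed.

Lemma mate_W a : inl a \in W -> hinc (mate e0 M a) a /\ ev (mate e0 M a) \in W.
Proof.
by move/mateP/matching_mem => [a' [e [_ eW h /set2_inl_inr[-> ->]]]].
Qed.

Lemma matching_ev e : e \in E0 -> exists2 a, inl a \in W & [set inl a; inr e] \in M.
Proof.
rewrite -mem_W_ev => eW; have /perfect_matchingP[_ /(_ _ eW)[A [AM eA _]]] := M_matching.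
have [a [e' [aW _ _ AE]]] := matching_mem AM; exists a => //.
by have <- : e' = e by [move: eA; rewrite AE => /set2P[//|[]]]; rewrite -AE.
Qed.

Lemma matched_edgesP x e : [set ov x; ev e] \in M -> e \in matched_edges M.
Proof. by move=> xM; rewrite inE; apply/existsP; exists x. Qed.

Lemma matched_edgesPn g e : [set fv g; ev e] \in M -> e \notin matched_edges M.
Proof.
by move=> gM; rewrite inE; apply/existsP => -[x /(matching_inl_uniq gM)].
Qed.

Lemma matched_edges_E0 : matched_edges M \subset E0.
Proof.
apply/subsetP => e; rewrite inE => /existsP[x /matching_mem].
by case=> a [e' [_ eW _ /set2_inl_inr[_ ->]]]; rewrite -mem_W_ev.
Qed.

Lemma mate_ov_image : (fun x => mate e0 M (inl x)) @: (~: primal_roots) = matched_edges M.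
Proof.
apply/setP => e; apply/imsetP/idP => [[x xR ->]|].
  by apply: matched_edgesP (mateP _); rewrite mem_W_ov -in_setC.
rewrite inE => /existsP[x xM]; exists x; last by rewrite (mate_uniq xM).
have [a [e' [aW _ _ /set2_inl_inr[aE _]]]] := matching_mem xM.
by rewrite in_setC -mem_W_ov /ov aE.
Qed.

Lemma mate_fv_image :
  (fun g => mate e0 M (inr g)) @: (~: dual_roots v') = E0 :\: matched_edges M.
Proof.
apply/setP => e; apply/imsetP/idP => [[g gR ->]|].
  have gW : fv g \in W by rewrite mem_W_fv -in_setC.
  by rewrite in_setD (matched_edgesPn (mateP gW)) -mem_W_ev; case: (mate_W gW).
rewrite in_setD => /andP[eF /matching_ev[[x|g] aW aM]].
  by rewrite (matched_edgesP aM) in eF.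
by exists g; rewrite ?in_setC -?mem_W_fv // (mate_uniq aM).
Qed.

Lemma mate_ov_assigned :
  assigned (@src G) (matched_edges M) primal_roots (fun x => mate e0 M (inl x)).
Proof.
split=> [x xR|x|x y].
- by rewrite -mate_ov_image; apply: imset_f.
- by rewrite in_setC -mem_W_ov => /mate_W[].
rewrite !in_setC -!mem_W_ov => /mateP xM /mateP yM xy; rewrite xy in xM.
by have [] := matching_inl_uniq xM yM.
Qed.

Lemma mate_fv_assigned :
  assigned (@rface G) (E0 :\: matched_edges M) (dual_roots v') (fun g => mate e0 M (inr g)).
Proof.
split=> [g gR|g|g h].
- by rewrite -mate_fv_image; apply: imset_f.
- by rewrite in_setC -mem_W_fv => /mate_W[/andP[]].
rewrite !in_setC -!mem_W_fv => /mateP gM /mateP hM gh; rewrite gh in gM.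
by have [] := matching_inl_uniq gM hM.
Qed.

Lemma card_matched_edges : #|matched_edges M| + #|primal_roots| = #|vertex G|.
Proof.
have [_ _ mI] := mate_ov_assigned; rewrite -mate_ov_image (card_in_imset mI).
by rewrite addnC cardsC.
Qed.

Lemma card_matched_dual : #|E0 :\: matched_edges M| + #|dual_roots v'| = #|face G|.
Proof.
have [_ _ mI] := mate_fv_assigned; rewrite -mate_fv_image (card_in_imset mI).
by rewrite addnC cardsC.
Qed.

Lemma matching_forest : forest v v' (matched_edges M).
Proof.
exact: (matched_forest matched_edges_E0 mate_ov_assigned mate_fv_assigned
  card_matched_edges card_matched_dual).
Qed.

End Matching.

Lemma matching_rooted M : edge G -> matching v v' M ->
  rooted (@src G) (matched_edges M) primal_roots
  /\ rooted (@rface G) (E0 :\: matched_edges M) (dual_roots v').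
Proof.
move=> e0 MM; split.
  exact: (matched_primal_rooted (matched_edges_E0 MM) (mate_ov_assigned e0 MM)
    (mate_fv_assigned e0 MM) (card_matched_edges e0 MM) (card_matched_dual e0 MM)).
exact: (matched_dual_rooted (matched_edges_E0 MM) (mate_ov_assigned e0 MM)
  (mate_fv_assigned e0 MM) (card_matched_edges e0 MM) (card_matched_dual e0 MM)).
Qed.

(** Both matchings assign the edges of the same two rooted forests, so [rooted_assigned_eq] makes
    their mates agree. *)
Lemma matching_edges_sub M M' : matching v v' M -> matching v v' M' ->
  matched_edges M = matched_edges M' -> M \subset M'.
Proof.
move=> MM MM' FF; apply/subsetP => A AM.
have [a [e0 [aW _ _ AE]]] := matching_mem MM AM; rewrite AE in AM *.
have [rP rD] := matching_rooted e0 MM.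
have mA := mate_ov_assigned e0 MM; have mA' := mate_ov_assigned e0 MM'.
have mB := mate_fv_assigned e0 MM; have mB' := mate_fv_assigned e0 MM'.
rewrite -FF in mA' mB'; rewrite -(mate_uniq e0 MM AM).
have -> : mate e0 M a = mate e0 M' a; last exact: (mateP e0 MM').
case: a aW {AM AE} => [x|g] aW.
  by apply: (rooted_assigned_eq rP mA mA'); rewrite in_setC -mem_W_ov.
by apply: (rooted_assigned_eq rD mB mB'); rewrite in_setC -mem_W_fv.
Qed.

Lemma matched_edges_inj M M' : matching v v' M -> matching v v' M' ->
  matched_edges M = matched_edges M' -> M = M'.
Proof.
by move=> MM MM' FF; apply/eqP; rewrite eqEsubset !matching_edges_sub.
Qed.

Lemma forest_matching F : forest v v' F ->
  exists2 M, matching v v' M & matched_edges M = F.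
Proof.
(* The boundary dart [d0] supplies the default edge. *)
move=> FF; have [d0 _] := outer_positions_exist; have FE := forest_E0 FF.
have rP := forest_primal_rooted FF; have rD := forest_dual_rooted FF.
have [mV mVA] := rooted_assigned d0.1 rP; have [mF mFA] := rooted_assigned d0.1 rD.
have imV := assigned_image mVA rP.2; have imF := assigned_image mFA rD.2.
case: mVA => mVF mVe mVI; case: mFA => mFD mFe mFI.
pose m (a : cell) := match a with inl x => mV x | inr g => mF g end.
have aW a : inl a \in W -> hinc (m a) a /\ m a \in E0.
  case: a => [x|g].
    rewrite [_ \in W]mem_W_ov -in_setC => xR.
    by split; [exact: mVe | exact: (subsetP FE _ (mVF _ xR))].
  rewrite [_ \in W]mem_W_fv -in_setC => gR; split.
    rewrite /hinc; apply/andP; split; last exact: mFe.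
    by apply: contraTneq gR => ->; rewrite in_setC negbK setU11.
  by have := mFD _ gR; rewrite in_setD => /andP[].
have mI a a' : inl a \in W -> inl a' \in W -> m a = m a' -> a = a'.
  have DF x g : fv g \in W -> ov x \in W -> mF g <> mV x.
    rewrite mem_W_ov mem_W_fv -!in_setC => gR xR gx.
    by have := mFD _ gR; rewrite in_setD gx (mVF _ xR).
  case: a a' => [x|g] [x'|g'] aW1 aW2 /= e.
  - by rewrite (mVI x x') // in_setC -mem_W_ov.
  - by case: (DF _ _ aW2 aW1).
  - by case: (DF _ _ aW1 aW2).
  - by rewrite (mFI g g') // in_setC -mem_W_fv.
pose M : {set {set hvert G}} := [set [set inl a; inr (m a)] | a in [set a | inl a \in W]].
have inM a : inl a \in W -> [set inl a; inr (m a)] \in M.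
  by move=> aW1; apply/imsetP; exists a; rewrite // in_set.
exists M.
  apply/perfect_matchingP; split=> [A /imsetP[a]|p pW].
    rewrite in_set => aW1 ->; have [h mE] := aW a aW1.
    by exists (inl a), (inr (m a)); split; rewrite // mem_W_ev.
  have [a aW1 pa] : exists2 a, inl a \in W & p \in [set inl a; inr (m a)].
    case: p pW => [a|e] pW; first by exists a; rewrite ?set21.
    have eE : e \in E0 by rewrite -mem_W_ev.
    have [eF|eF] := boolP (e \in F).
      have : e \in mV @: (~: primal_roots) by rewrite imV.
      by case/imsetP => x xR ->; exists (inl x); rewrite ?set22 // mem_W_ov -in_setC.
    have : e \in mF @: (~: dual_roots v') by rewrite imF in_setD eF.
    by case/imsetP => g gR ->; exists (inr g); rewrite ?set22 // mem_W_fv -in_setC.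
  exists [set inl a; inr (m a)]; split; rewrite ?inM // => B /imsetP[a']; rewrite in_set.
  move=> a'W -> pa'; suff -> : a = a' by [].
  case: p pa pa' {pW} => [b|e].
    by move=> /set2P[[->]|//] /set2P[[->]|].
  by move=> /set2P[//|[->]] /set2P[//|[/mI]]; apply.
apply/setP => e; rewrite in_set; apply/existsP/idP => [[x /imsetP[a]]|eF].
  rewrite in_set => aW1 /set2_inl_inr[ax ->]; rewrite -ax /=.
  by apply: mVF; rewrite in_setC -mem_W_ov /ov ax.
have : e \in mV @: (~: primal_roots) by rewrite imV.
by case/imsetP => x xR ->; exists x; apply: (inM (inl x)); rewrite mem_W_ov -in_setC.
Qed.

Lemma matching_weight_edges (R : comNzRingType) (w : edge G -> R) M :
  matching v v' M -> forest_weight w (matched_edges M) = matching_weight w M.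
Proof.
move=> MM; have [d0 _] := outer_positions_exist; pose e0 := d0.1.
have [_ _ mI] := mate_ov_assigned e0 MM.
rewrite /forest_weight -(mate_ov_image e0 MM) (big_imset _ mI) /=.
rewrite /matching_weight.
rewrite (bigID (fun A : {set hvert G} => [exists x, exists e, A == [set ov x; ev e]])) /=.
(* Pairs containing a face-vertex have weight 1. *)
rewrite [X in (_ * X)%R]big1 ?GRing.mulr1; last first.
  move=> A /andP[_ noA]; rewrite /hedge_weight; case: pickP => // -[x e] /= AE.
  by case/negP: noA; apply/existsP; exists x; apply/existsP; exists e.
pose h x : {set hvert G} := [set ov x; ev (mate e0 M (inl x))].
have hI : {in ~: primal_roots &, injective h} by move=> x y _ _ /set2_inl_inr[[]].
rewrite (eq_bigl (mem (h @: (~: primal_roots)))) => [|A]; last first.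
  apply/andP/imsetP => [[AM /existsP[x /existsP[e /eqP AE]]]|[x xR ->]].
    rewrite AE in AM *; exists x; last by rewrite /h (mate_uniq e0 MM AM).
    have [a [e' [aW _ _ /set2_inl_inr[aE _]]]] := matching_mem MM AM.
    by rewrite in_setC -mem_W_ov /ov aE.
  split; first by apply: (mateP e0 MM); rewrite [_ \in W]mem_W_ov -in_setC.
  by apply/existsP; exists x; apply/existsP; exists (mate e0 M (inl x)).
rewrite (big_imset _ hI) /=; apply: eq_bigr => x _.
rewrite /hedge_weight; case: pickP => [[y e] /= /eqP/set2_inl_inr[_ ->] //|].
by move/(_ (x, mate e0 M (inl x))); rewrite eqxx.
Qed.

(** * Matchings along prescribed paths *)

Lemma path_matching_mem M (k : 'I_N) (r : seq (hvert G)) N' p : matching v v' M ->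
    perfect_matching (path_adj r) ([set y in r] :\ terminal v' k) N' ->
    N' \subset M -> p \in r -> p != terminal v' k ->
  exists a e, [/\ [set inl a; inr e] \in M, p \in [set inl a; inr e],
    inl a \in r & inr e \in r].
Proof.
move=> MM /perfect_matchingP[NE NU] /subsetP NM pr pk.
have [|A [AN pA _]] := NU p; first by rewrite in_setD1 pk inE.
have [a [e [_ _ _ AE]]] := matching_mem MM (NM _ AN).
have [x [y [xr yr _ _ Axy]]] := NE A AN.
have Ar q : q \in A -> q \in r.
  rewrite Axy => /set2P[->|->]; first by move: xr; rewrite in_setD1 inE => /andP[].
  by move: yr; rewrite in_setD1 inE => /andP[].
exists a, e; rewrite -AE; split=> //; first exact: NM.
  by apply: Ar; rewrite AE set21.
by apply: Ar; rewrite AE set22.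
Qed.

(** Forward, an edge-vertex of the path is matched within the path, hence to an original vertex, so
    its edge is in the forest. Conversely, [assigned_walk] shows that the matching follows the path
    to its root. *)
Lemma primal_path_matching M (k : 'I_N) r : matching v v' M -> ~~ odd k ->
    subdivided_path (v k) (v' k) r ->
  (exists2 N', perfect_matching (path_adj r) ([set y in r] :\ terminal v' k) N'
    & N' \subset M) <-> path_in_forest (G0_verts v v') (matched_edges M) r.
Proof.
move=> MM ek [p [wp up lp] rE]; pose c : vertex G -> cell := inl.
have {}rE : r = subdivision (@src G) c (v k) p by [].
have tk : terminal v' k = inl (c (v' k)) by rewrite /terminal (negPf ek).
split=> [[N' NP NM]|[_ pF]].
  split=> [x xr|e er].
    rewrite inE; have [xk|xk] := eqVneq (ov x) (terminal v' k).
      by move: xk; rewrite tk => -[->]; exact: v'_even.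
    have [a [e [aM xa _ _]]] := path_matching_mem MM NP NM xr xk.
    have [a' [e' [aW _ _ /set2_inl_inr[aE _]]]] := matching_mem MM aM.
    have xE : ov x = inl a by case/set2P: xa.
    rewrite -aE -xE [_ \in W]mem_W_ov in aW.
    by apply: contraNN aW => xS; apply/primal_rootP; left.
  have ek' : ev e != terminal v' k by rewrite tk.
  have [a [e' [aM ea ar _]]] := path_matching_mem MM NP NM er ek'.
  have <- : e' = e by case/set2P: ea => // -[].
  move: ar; rewrite rE mem_subdivision_inl => /mapP[x _ ax].
  by rewrite ax in aM; exact: matched_edgesP aM.
have [d0 _] := outer_positions_exist; pose e0 := d0.1.
have pF' : {in p, forall d, d.1 \in matched_edges M}.
  by move=> d dp; apply: pF; rewrite rE mem_subdivision_inr map_f.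
have lR : last (v k) [seq src (flip d) | d <- p] \in primal_roots.
  by rewrite [last _ _]lp primal_root_v'.
have aw := assigned_walk (mate_ov_assigned e0 MM) (card_matched_edges e0 MM) wp up lR pF'.
rewrite tk -lp rE; apply: (subdivision_matching _ MM wp); first by move=> x y [].
  move=> d dp; have [dR _] := aw d dp.
  by apply: contraNneq dR => ->.
move=> d dp; have [dR <-] := aw d dp; apply: (mateP e0 MM).
by rewrite [_ \in W]mem_W_ov.
Qed.

(** The dual argument. The path starts in the channel containing [smash_face (v k)] and crosses no
    edge of the forest, so it stays in that channel. *)
Lemma dual_path_matching M (k : 'I_N) r : matching v v' M -> odd k ->
    subdivided_dual_path (smash_face (v k)) (smash_face (v' k)) r ->
  (exists2 N', perfect_matching (path_adj r) ([set y in r] :\ terminal v' k) N'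
    & N' \subset M) <-> path_in_channel (matched_edges M) r.
Proof.
move=> MM ok [p [[wp up lp] /allP sp] rE]; pose c : face G -> cell := inr.
have {}rE : r = subdivision (@rface G) c (smash_face (v k)) p by [].
have tk : terminal v' k = inl (c (smash_face (v' k))) by rewrite /terminal ok.
have [d0 _] := outer_positions_exist; pose e0 := d0.1.
split=> [[N' NP NM]|[C [_ _ pF]]].
  have rF e : ev e \in r -> e \notin matched_edges M.
    move=> er; have ek' : ev e != terminal v' k by rewrite tk.
    have [a [e' [aM ea ar _]]] := path_matching_mem MM NP NM er ek'.
    have <- : e' = e by case/set2P: ea => // -[].
    move: ar; rewrite rE mem_subdivision_inl => /mapP[g _ ag].
    by rewrite ag in aM; exact: (matched_edgesPn MM aM).
  have [_ _ _ _ /(_ k ok)[C CF [fC _]]] := matching_forest e0 MM.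
  exists C; split=> // g; rewrite rE mem_subdivision_inl => /mapP[h hp [->]].
  have pF : {in p, forall d, d.1 \notin matched_edges M}.
    by move=> d dp; apply: rF; rewrite rE mem_subdivision_inr map_f.
  case: CF => -[g1 _ CE] _; rewrite CE inE in fC *.
  elim: p (smash_face (v k)) wp fC hp sp pF {up lp rE} => [|d p IH] f /=.
    by move=> _ gf; rewrite mem_seq1 => /eqP->; rewrite ?inE.
  case/andP=> /eqP df wp gf; rewrite in_cons => /predU1P[->|hp] sp pF; first by rewrite ?inE.
  apply: (IH (lface d)) => //.
  - apply: connect_trans gf (connect1 _); apply/existsP; exists d.
    by rewrite df !eqxx pF ?mem_head // sp ?mem_head.
  - by move=> d' d'p; apply: sp; rewrite inE d'p orbT.
  by move=> d' d'p; apply: pF; rewrite inE d'p orbT.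
have pD : {in p, forall d, d.1 \in E0 :\: matched_edges M}.
  move=> d dp; rewrite in_setD separates_E0 ?sp // andbT.
  by apply: pF; rewrite rE mem_subdivision_inr map_f.
have lR : last (smash_face (v k)) [seq rface (flip d) | d <- p] \in dual_roots v'.
  by rewrite [last _ _]lp; apply/dual_rootP; right; exists k.
have aw := assigned_walk (mate_fv_assigned e0 MM) (card_matched_dual e0 MM) wp up lR pD.
rewrite tk -lp rE; apply: (subdivision_matching _ MM wp); first by move=> x y [].
  move=> d dp; have [dR _] := aw d dp.
  by apply: contraNneq dR => ->.
move=> d dp; have [dR <-] := aw d dp; apply: (mateP e0 MM).
by rewrite [_ \in W]mem_W_fv.
Qed.

Lemma matching_along_forest P (I : {set 'I_N}) M : path_system v v' P ->
    matching v v' M ->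
  matching_along v v' P I M <-> forest_along v v' P I (matched_edges M).
Proof.
move=> [PV PF _] MM; have [d0 _] := outer_positions_exist.
have FM := matching_forest d0.1 MM; rewrite /matching_along /forest_along.
have Pk k : (exists2 N', perfect_matching (path_adj (P k))
      ([set y in P k] :\ terminal v' k) N' & N' \subset M)
    <-> (if odd k then path_in_channel (matched_edges M) (P k)
         else path_in_forest (G0_verts v v') (matched_edges M) (P k)).
  case: (boolP (odd k)) => [ok|ek].
    exact: dual_path_matching (PF k ok).
  exact: primal_path_matching (PV k ek).
by split=> -[_ H]; split=> // k kI; apply/Pk/H.
Qed.

(** The same map [matched_edges] serves both claims; only the conditions that correspond to each
    other change. *)
Lemma matched_edges_bijection (R : comNzRingType) (w : edge G -> R)
    (A : {set {set hvert G}} -> Prop) (B : {set edge G} -> Prop) :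
    (forall M, A M -> matching v v' M) -> (forall F, B F -> forest v v' F) ->
    (forall M, matching v v' M -> A M <-> B (matched_edges M)) ->
  weight_preserving_bijection A B (matching_weight w) (forest_weight w).
Proof.
move=> AM BF AB; exists matched_edges; split.
- by move=> M AM'; apply/AB => //; exact: AM.
- by move=> M M' /AM MM /AM MM'; exact: matched_edges_inj.
- move=> F BF'; have [M MM MF] := forest_matching (BF F BF'); exists M => //.
  by apply/AB; rewrite ?MF.
by move=> M /AM MM; exact: matching_weight_edges.
Qed.

End Configuration.

Theorem theorem5p4 (R : comNzRingType) (G : plane_graph) (w : edge G -> R)
    (n : nat) (v v' : 'I_n.*2.+1 -> vertex G)
    (G_leaf : no_inner_leaf G)
    (v'_path : sorted (@adj G) (codom v') /\ uniq (codom v'))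
    (v_order : ccw_on_outer (codom v ++ seq.rev (codom v')))
    (v_deg : forall x, x \in smashed v v' -> deg x = 2)
    (v_faces : uniq (outer G :: map (@smash_face G) (smashed v v'))) :
  weight_preserving_bijection (matching v v') (forest v v')
    (matching_weight w) (forest_weight w)
  /\ (forall P : 'I_n.*2.+1 -> seq (hvert G), path_system v v' P ->
      forall I : {set 'I_n.*2.+1},
        weight_preserving_bijection (matching_along v v' P I)
          (forest_along v v' P I) (matching_weight w) (forest_weight w)).
Proof.
split.
  apply: (matched_edges_bijection v'_path v_order v_deg v_faces w) => // M MM.
  have [d0 _] := outer_positions_exist v_order; split=> // _.
  exact: (matching_forest v'_path v_order v_deg v_faces d0.1 MM).
move=> P PS I; apply: (matched_edges_bijection v'_path v_order v_deg v_faces w).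
- by move=> M [].
- by move=> F [].
by move=> M; exact: matching_along_forest.
Qed.
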